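(* Let $\mathcal{X},\mathcal{Y}$ be finite alphabets, $P_X$ a distribution on $\mathcal{X}$ and $P_{Y|X}$ a channel from $\mathcal{X}$ to $\mathcal{Y}$, with $P_{XY}=P_XP_{Y|X}$ and output distribution $P_Y$. Assume the channel is non-degenerate, i.e. $P_{Y^n|X^n}\neq P_{Y^n}$. For any $R>I(P_X,P_{Y|X})$, let $M=\lceil \exp(nR)\rceil$ and let $P_{Y^n|\mathscr{C}_M^n}$ be the induced output distribution of the random i.i.d. codebook $\mathscr{C}_M^n$. Then \[ \lim_{n\to\infty}-\frac1n\log\mathbb{E}\left[\left\|P_{Y^n|\mathscr{C}_M^n}-P_{Y^n}\right\|_1\right] =\min_{Q_{XY}\in\mathcal{P}(\mathcal{X}\times\mathcal{Y})}\Big\{D(Q_{XY}\|P_{XY})+\tfrac12\big[R-D(Q_{XY}\|P_XQ_Y)\big]_+\Big\} =\max_{\lambda\in[1,2]}\Big\{\frac{\lambda-1}{\lambda}\big(R-I^{\mathsf{s}}_\lambda(P_X,P_{Y|X})\big)\Big\}, \] where $Q_Y$ denotes the $\mathcal{Y}$-marginal of $Q_{XY}$ and $[f]_+=\max\{0,f\}$.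
   Context: Logarithms and exponentials are to an arbitrary but common base. $P_{X^n}$, $P_{Y^n}$ are the i.i.d. extensions of $P_X$, $P_Y$, and $P_{Y^n|X^n}(y^n|x^n)=\prod_{i=1}^nP_{Y|X}(y_i|x_i)$ is the memoryless extension of the channel. The random i.i.d. codebook $\mathscr{C}_M^n=\{X_1^n,\dots,X_M^n\}$ consists of $M$ codewords drawn independently from $P_{X^n}$, and the induced output distribution is the random distribution $P_{Y^n|\mathscr{C}_M^n}(y^n)=\frac1M\sum_{j=1}^MP_{Y^n|X^n}(y^n|X_j^n)$. The total variation distance is $\|P-Q\|_1=\sum_{x}|P(x)-Q(x)|$ (no factor $1/2$). $D(\cdot\|\cdot)$ is relative entropy and $I(P_X,P_{Y|X})=D(P_{XY}\|P_XP_Y)$ is mutual information. Sibson's $\alpha$-mutual information of order $\lambda>0$, $\lambda\neq1$, is $I^{\mathsf{s}}_\lambda(P_X,P_{Y|X})=\frac{\lambda}{\lambda-1}\log\sum_{y\in\mathcal{Y}}\big(\sum_{x\in\mathcal{X}}P_X(x)P_{Y|X}^\lambda(y|x)\big)^{1/\lambda}$, and $I^{\mathsf{s}}_1=I(P_X,P_{Y|X})$ (so the objective in the maximization equals $0$ at $\lambda=1$). *)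

(* Defs.v *)
From HB Require Import structures.
From mathcomp Require Import all_boot all_order all_algebra.
From mathcomp Require Import all_classical all_reals all_analysis.
Set Implicit Arguments. Unset Strict Implicit. Unset Printing Implicit Defensive.
Import Order.TTheory GRing.Theory Num.Theory.
Local Open Scope ring_scope.

Section Defs.
Variable R : realType.

(* logarithm to base b (b > 1 fixed, common to log and exp) *)
Definition logb (b x : R) : R := ln x / ln b.

Definition is_dist (T : finType) (P : T -> R) : Prop :=
  (forall t, 0 <= P t) /\ \sum_t P t = 1.

Variables X Y : finType.

Definition is_channel (W : X -> Y -> R) : Prop := forall x, is_dist (W x).

Definition outdist (PX : X -> R) (W : X -> Y -> R) (y : Y) : R :=
  \sum_x PX x * W x y.

Definition joint (PX : X -> R) (W : X -> Y -> R) (p : X * Y) : R :=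
  PX p.1 * W p.1 p.2.

Definition margY (Q : X * Y -> R) (y : Y) : R := \sum_x Q (x, y).

Definition divR (T : finType) (b : R) (Q P : T -> R) : R :=
  \sum_(t | Q t != 0) Q t * logb b (Q t / P t).

Definition divE (T : finType) (b : R) (Q P : T -> R) : \bar R :=
  if [exists t, (Q t != 0) && (P t == 0)] then +oo%E else (divR b Q P)%:E.

(* mutual information I(P_X, P_{Y|X}) = D(P_XY || P_X P_Y) (always finite) *)
Definition mutinfo (b : R) (PX : X -> R) (W : X -> Y -> R) : R :=
  divR b (joint PX W) (fun p => PX p.1 * outdist PX W p.2).

Definition sibson (b : R) (PX : X -> R) (W : X -> Y -> R) (lam : R) : R :=
  if lam == 1 then mutinfo b PX W
  else lam / (lam - 1) *
       logb b (\sum_y (\sum_x PX x * (W x y) `^ lam) `^ lam^-1).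

Definition objQ (b Rt : R) (PX : X -> R) (W : X -> Y -> R) (Q : X * Y -> R)
  : \bar R :=
  (divE b Q (joint PX W) +
   (2^-1)%:E * maxe 0%E (Rt%:E - divE b Q (fun p => (PX p.1 * margY Q p.2)%R)))%E.

Definition objL (b Rt : R) (PX : X -> R) (W : X -> Y -> R) (lam : R) : R :=
  (lam - 1) / lam * (Rt - sibson b PX W lam).

Definition codeM (b Rt : R) (n : nat) : nat :=
  `|Num.ceil (b `^ (n%:R * Rt))|%N.

Definition prob_code (PX : X -> R) (n M : nat)
  (c : {ffun 'I_M -> {ffun 'I_n -> X}}) : R :=
  \prod_(j < M) \prod_(i < n) PX (c j i).

Definition induced (W : X -> Y -> R) (n M : nat)
  (c : {ffun 'I_M -> {ffun 'I_n -> X}}) (y : {ffun 'I_n -> Y}) : R :=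
  M%:R^-1 * \sum_(j < M) \prod_(i < n) W (c j i) (y i).

Definition outn (PX : X -> R) (W : X -> Y -> R) (n : nat) (y : {ffun 'I_n -> Y}) : R :=
  \prod_(i < n) outdist PX W (y i).

Definition expTV (b Rt : R) (PX : X -> R) (W : X -> Y -> R) (n : nat) : R :=
  \sum_(c : {ffun 'I_(codeM b Rt n) -> {ffun 'I_n -> X}})
    prob_code PX c * \sum_(y : {ffun 'I_n -> Y}) `|induced W c y - outn PX W y|.

End Defs.

(* Main.v *)
Require Import Defs.
From HB Require Import structures.
From mathcomp Require Import all_boot all_order all_algebra.
From mathcomp Require Import all_classical all_reals all_analysis.
From mathcomp Require Import ring lra complex.
Import Order.TTheory GRing.Theory Num.Theory numFieldNormedType.Exports.
Local Open Scope classical_set_scope.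
Local Open Scope ring_scope.
Set Implicit Arguments.
Unset Strict Implicit.
Unset Printing Implicit Defensive.

(** Everything is done in nats, with [r = Rt ln b]; [P], [W], [P_Y] are the
    input distribution, the channel and the output distribution.

    Min-max.  For [s = (lam - 1) / lam] the Lagrangian
    [D(Q||P W) + s (r - D(Q||P Q_Y))] equals
    [s r - ln Z + D(Q||Q_lam) / lam + s D(Q_Y||(Q_lam)_Y)] with [Q_lam]
    proportional to [P W^lam A^(1/lam - 1)], [A(y) = sum_x P W^lam] and
    [Z = sum_y A^(1/lam)], so [Q_lam] minimizes it.  Since
    [D(Q_1||P (Q_1)_Y) = I < r], the intermediate value theorem gives [lam] in
    [1,2] with [D(Q_lam||P (Q_lam)_Y) = r], or else [lam = 2] has [<= r]; this
    pair [(lam, Q_lam)] is a saddle point.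

    Upper bound on the expected distance.  For each [y^n] the deviation is that
    of a sum of [M] independent nonnegative variables [xi = W^n(y^n|X_j)] from
    its mean, at most [3 (M E xi^lam)^(1/lam)] by truncation at that level.
    The sum over [y^n] factorizes.

    Lower bound.  [theta E|S - m| >= E(1 - cos(theta (S - m)))], and the
    characteristic function of [S] is an [M]-th power, so this is of order
    [min(1, M q)] with [q = E(1 - cos(theta (xi - xi')))].  Restricting [xi] to
    the [x^n] that are jointly typical with [y^n] under [Q_lam], and [xi'] to
    values below twice its mean, bounds [q] from below by the probability of
    this typical set, which a change of measure to [Q_lam] evaluates. *)

(** * Independent samples *)

Section Iid.
Context {R : realType}.

Definition mean (T : finType) (P f : T -> R) : R := \sum_t P t * f t.

Definition iid (T : finType) (P : T -> R) (n : nat) (c : {ffun 'I_n -> T}) : R :=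
  \prod_(i < n) P (c i).
Arguments iid {T} P {n} c.

Section Mean.
Variables (T : finType) (P : T -> R).

Lemma mean_ge0 (f : T -> R) :
  (forall t, 0 <= P t) -> (forall t, 0 <= f t) -> 0 <= mean P f.
Proof. by move=> P0 f0; apply: sumr_ge0 => t _; apply: mulr_ge0. Qed.

Lemma ler_mean (f g : T -> R) :
  (forall t, 0 <= P t) -> (forall t, f t <= g t) -> mean P f <= mean P g.
Proof. by move=> P0 fg; apply: ler_sum => t _; apply: ler_wpM2l. Qed.

Lemma eq_mean (f g : T -> R) : f =1 g -> mean P f = mean P g.
Proof. by move=> fg; apply: eq_bigr => t _; rewrite fg. Qed.

Lemma meanD (f g : T -> R) :
  mean P (fun t => f t + g t) = mean P f + mean P g.
Proof. by rewrite -big_split; apply: eq_bigr => t _; rewrite /= mulrDr. Qed.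

Lemma meanB (f g : T -> R) :
  mean P (fun t => f t - g t) = mean P f - mean P g.
Proof. by rewrite -sumrB; apply: eq_bigr => t _; rewrite mulrBr. Qed.

Lemma meanZ (k : R) (f : T -> R) : mean P (fun t => k * f t) = k * mean P f.
Proof. by rewrite mulr_sumr; apply: eq_bigr => t _; rewrite mulrCA. Qed.

Lemma mean_cst (k : R) : is_dist P -> mean P (fun=> k) = k.
Proof. by case=> _ P1; rewrite /mean -mulr_suml P1 mul1r. Qed.

Lemma mean_sum (I : Type) (r : seq I) (p : pred I) (F : I -> T -> R) :
  mean P (fun t => \sum_(i <- r | p i) F i t) = \sum_(i <- r | p i) mean P (F i).
Proof.
by rewrite exchange_big; apply: eq_bigr => t _; rewrite mulr_sumr.
Qed.

End Mean.

Section Product.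
Variables (T : finType) (P : T -> R) (n : nat).

(** Distributivity of product over sum. This is the only form in which independence enters;
    statements on one or two coordinates follow by taking the remaining factors equal to 1. *)
Lemma mean_iid_prod (F : 'I_n -> T -> R) :
  mean (iid P) (fun c : {ffun 'I_n -> T} => \prod_i F i (c i)) =
  \prod_i mean P (F i).
Proof.
rewrite /mean bigA_distr_bigA; apply: eq_bigr => c _.
by rewrite /iid -big_split.
Qed.

Hypothesis dP : is_dist P.

Lemma iid_ge0 (c : {ffun 'I_n -> T}) : 0 <= iid P c.
Proof. by apply: prodr_ge0 => i _; case: dP. Qed.

Lemma iid_dist : is_dist (@iid _ P n).
Proof.
split; first exact: iid_ge0.
have := mean_iid_prod (fun _ _ => 1).
rewrite [RHS]big1 => [<-|i _]; last exact: mean_cst.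
by apply: eq_bigr => c _; rewrite big1 ?mulr1.
Qed.

Lemma mean_iid_coord (g : T -> R) (j : 'I_n) :
  mean (iid P) (fun c : {ffun 'I_n -> T} => g (c j)) = mean P g.
Proof.
transitivity (\prod_i mean P (fun t => if i == j then g t else 1)).
  rewrite -mean_iid_prod; apply: eq_mean => c.
  by rewrite -big_mkcond big_pred1_eq.
rewrite (bigD1 j) //= eqxx big1 ?mulr1 // => i /negbTE ->.
exact: mean_cst.
Qed.

Lemma mean_iid_coord2 (g h : T -> R) (j k : 'I_n) : j != k ->
  mean (iid P) (fun c : {ffun 'I_n -> T} => g (c j) * h (c k)) =
  mean P g * mean P h.
Proof.
move=> jk.
transitivity (\prod_i mean P (fun t => (if i == j then g t else 1) *
                                       (if i == k then h t else 1))).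
  rewrite -mean_iid_prod; apply: eq_mean => c.
  by rewrite big_split /= -!big_mkcond !big_pred1_eq.
have kj : k != j by rewrite eq_sym.
rewrite (bigD1 j) //= (bigD1 k) //= !eqxx (negbTE jk) (negbTE kj) mulrA.
rewrite big1 => [|i /andP[/negbTE-> /negbTE->]].
  by rewrite mulr1; congr (_ * _); apply: eq_mean => t; rewrite ?mulr1 ?mul1r.
by rewrite mulr1 mean_cst.
Qed.

Lemma mean_iid_sum (g : T -> R) :
  mean (iid P) (fun c : {ffun 'I_n -> T} => \sum_j g (c j)) = n%:R * mean P g.
Proof.
rewrite mean_sum (eq_bigr (fun=> mean P g)) => [|j _]; last exact: mean_iid_coord.
by rewrite sumr_const card_ord mulr_natl.
Qed.

Lemma mean_iid_sqr (g : T -> R) : mean P g = 0 ->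
  mean (iid P) (fun c : {ffun 'I_n -> T} => (\sum_j g (c j)) ^+ 2) =
  n%:R * mean P (fun t => g t ^+ 2).
Proof.
move=> g0.
rewrite (@eq_mean _ _ _ (fun c : {ffun 'I_n -> T} =>
    \sum_j \sum_k g (c j) * g (c k))) => [|c]; last first.
  by rewrite expr2 mulr_suml; apply: eq_bigr => j _; rewrite mulr_sumr.
rewrite mean_sum (eq_bigr (fun=> mean P (fun t => g t ^+ 2))) => [|j _].
  by rewrite sumr_const card_ord mulr_natl.
rewrite mean_sum (bigD1 j) //= big1 => [|k kj].
  by rewrite addr0 -(mean_iid_coord _ j); apply: eq_mean => c; rewrite expr2.
by rewrite mean_iid_coord2 1?eq_sym // g0 mul0r.
Qed.

(** Cross terms of the centered variables vanish, and a variance is at most the second moment. *)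
Lemma mean_iid_sqr_centered (g : T -> R) :
  mean (iid P) (fun c : {ffun 'I_n -> T} =>
    (\sum_j g (c j) - n%:R * mean P g) ^+ 2) <=
  n%:R * mean P (fun t => g t ^+ 2).
Proof.
set m := mean P g.
have c0 : mean P (fun t => g t - m) = 0 by rewrite meanB mean_cst // subrr.
rewrite (@eq_mean _ _ _ (fun c : {ffun 'I_n -> T} =>
    (\sum_j (g (c j) - m)) ^+ 2)) => [|c]; last first.
  by rewrite sumrB sumr_const card_ord mulr_natl.
rewrite (mean_iid_sqr c0); apply: ler_wpM2l => //.
rewrite (@eq_mean _ _ _ (fun t => (g t ^+ 2 - (2 * m) * g t) + m ^+ 2)) => [|t].
  rewrite meanD meanB meanZ mean_cst // -/m; have := sqr_ge0 m; lra.
by ring.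
Qed.

(* [|z| <= (z^2 / a + a) / 2] *)
Lemma mean_norm_le_sqr (f : T -> R) (a : R) : 0 < a ->
  mean P (fun t => `|f t|) <= (mean P (fun t => f t ^+ 2) / a + a) / 2.
Proof.
move=> a0; have [P0 _] := dP.
apply: (@le_trans _ _ (mean P (fun t => ((2 * a)^-1 * f t ^+ 2 + a / 2)))).
  apply: ler_mean => // t; rewrite -(ler_pM2l a0) -real_normK ?num_real //.
  have a2 : a * (2 * a)^-1 = 2^-1 by field; rewrite gt_eqF.
  rewrite mulrDr mulrA a2.
  have := sqr_ge0 (`|f t| - a); rewrite sqrrB; lra.
rewrite meanD (meanZ P _ (fun t => f t ^+ 2)) mean_cst // le_eqVlt.
apply/orP; left; apply/eqP.
by field; rewrite gt_eqF.
Qed.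

End Product.

End Iid.
Arguments iid {R T} P {n} c.

(** * Mean absolute deviation of sums of independent variables *)

Section CharacteristicFunction.
Context {R : realType}.
Local Open Scope complex_scope.

Let expi (t : R) : R[i] := cos t +i* sin t.

Let expiD (a b : R) : expi (a + b) = expi a * expi b.
Proof.
by apply/eqP; rewrite /expi cosD sinD eq_complex /= eqxx [X in X == _]addrC eqxx.
Qed.

Let expi_sum (n : nat) (f : 'I_n -> R) :
  expi (\sum_i f i) = \prod_i expi (f i).
Proof. by apply: (big_morph expi expiD); rewrite /expi cos0 sin0. Qed.

Let Re_mean (T : finType) (P f : T -> R) :
  complex.Re (\sum_t (P t)%:C * expi (f t)) = mean P (cos \o f).
Proof. by rewrite raddf_sum; apply: eq_bigr => t _ /=; rewrite mul0r subr0. Qed.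

Let Im_mean (T : finType) (P f : T -> R) :
  complex.Im (\sum_t (P t)%:C * expi (f t)) = mean P (sin \o f).
Proof. by rewrite raddf_sum; apply: eq_bigr => t _ /=; rewrite mul0r addr0. Qed.

(** Both sides are squared moduli of characteristic functions, split into real and imaginary parts.
    The characteristic function of the sum is an [n]-th power because [expi] turns sums into
    products. *)
Lemma chf_iid (T : finType) (P g : T -> R) (n : nat) :
  mean (iid P) (fun c : {ffun 'I_n -> T} => cos (\sum_j g (c j))) ^+ 2 +
  mean (iid P) (fun c : {ffun 'I_n -> T} => sin (\sum_j g (c j))) ^+ 2 =
  (mean P (cos \o g) ^+ 2 + mean P (sin \o g) ^+ 2) ^+ n.
Proof.
have chfX : \sum_(c : {ffun 'I_n -> T})
    (iid P c)%:C * expi (\sum_j g (c j)) = (\sum_t (P t)%:C * expi (g t)) ^+ n.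
  rewrite -[in RHS](card_ord n) -prodr_const bigA_distr_bigA.
  by apply: eq_bigr => c _; rewrite big_split -expi_sum /iid rmorph_prod.
apply: (@complexI R); rewrite rmorphXn /= -!Re_mean -!Im_mean !add_Re2_Im2.
by rewrite chfX normrX exprAC.
Qed.

End CharacteristicFunction.

(** * Lower bound on the mean deviation by characteristic functions *)

Section MeanDeviationLower.
Context {R : realType}.

Lemma cos_ge1B (x : R) : 1 - cos x <= `|x|.
Proof.
wlog x0 : x / 0 <= x.
  move=> H; have [/H//|x0] := leP 0 x.
  by rewrite -cosN -normrN; apply: H; lra.
rewrite ger0_norm //; move: x0; rewrite le_eqVlt => /predU1P[<-|x0].
  by rewrite cos0 subrr.
have [y _] := @MVT R cos (fun t => - sin t) 0 x x0
  (fun y _ => is_derive_cos y) (continuous_subspaceT (@continuous_cos R)).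
rewrite cos0 subr0 => E; have : 1 - cos x = sin y * x by lra.
by move=> ->; rewrite ler_piMl ?sin_le1 // ltW.
Qed.

(** Half-angle formula: [1 - cos x = 2 sin(x/2)^2], and by the mean value theorem
    [sin(x/2) = cos y * (x/2)] with [0 < y < 1/2], where [cos y >= 1/2]. *)
Lemma sqr_le_1Bcos (x : R) : `|x| <= 1 -> x ^+ 2 / 8 <= 1 - cos x.
Proof.
wlog x0 : x / 0 <= x.
  move=> H; have [/H//|x0] := leP 0 x => x1.
  by rewrite -cosN -sqrrN; apply: H; rewrite ?normrN //; lra.
rewrite ger0_norm //; move: x0; rewrite le_eqVlt => /predU1P[<-|x0 x1].
  by rewrite cos0 subrr expr0n mul0r.
have h0 : 0 < x / 2 by lra.
have [y] := @MVT R sin cos 0 (x / 2) h0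
  (fun y _ => is_derive_sin y) (continuous_subspaceT (@continuous_sin R)).
rewrite in_itv /= sin0 !subr0 => /andP[y0 yx] E.
have cy : 1 / 2 <= cos y by have := cos_ge1B y; rewrite gtr0_norm //; lra.
have -> : cos x = 1 - 2 * sin (x / 2) ^+ 2.
  have -> : x = x / 2 + x / 2 by lra.
  rewrite cosD -!expr2; have -> : (x / 2 + x / 2) / 2 = x / 2 by lra.
  have := cos2Dsin2 (x / 2); lra.
have c2 : 1 / 4 <= cos y ^+ 2 by nra.
rewrite E exprMn; have := sqr_ge0 x; nra.
Qed.

(** Induction on [M], using [(1 - q) (1 + (M + 1) q) <= 1 + M q]. *)
Lemma onem_exp_le (q : R) (M : nat) : 0 <= q <= 1 ->
  (1 - q) ^+ M * (1 + M%:R * q) <= 1.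
Proof.
move=> /andP[q0 q1]; elim: M => [|M IH]; first by rewrite expr0; lra.
apply: le_trans IH; rewrite exprSr -mulrA.
apply: ler_wpM2l; first by apply: exprn_ge0; lra.
have : (0 : R) <= M%:R by []; rewrite -natr1; nra.
Qed.

Variables (T : finType) (P : T -> R).
Hypothesis dP : is_dist P.

(** The squared modulus of a characteristic function is the characteristic function of the
    difference of two independent copies. *)
Lemma chf_symmetrized (g : T -> R) :
  mean P (cos \o g) ^+ 2 + mean P (sin \o g) ^+ 2 =
  1 - \sum_t \sum_u P t * P u * (1 - cos (g t - g u)).
Proof.
have [_ P1] := dP.
have -> : \sum_t \sum_u P t * P u * (1 - cos (g t - g u)) =
    (\sum_t P t) * (\sum_u P u) - \sum_t \sum_u P t * P u * cos (g t - g u).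
  rewrite mulr_suml -sumrB; apply: eq_bigr => t _.
  by rewrite mulr_sumr -sumrB; apply: eq_bigr => u _; rewrite mulrBr mulr1.
rewrite P1 mulr1 subKr !expr2 /mean !mulr_suml -big_split /=.
apply: eq_bigr => t _; rewrite !mulr_sumr -big_split /=.
by apply: eq_bigr => u _; rewrite cosB; ring.
Qed.

(** With [C] the mean of [cos (theta (S - m))], the left-over [1 - C] is at most [theta] times the
    mean deviation. The shift by [m] only rotates the characteristic function, so [C^2] is at most
    its squared modulus [(1 - q)^M]. *)
Lemma mean_deviation_ge (M : nat) (xi : T -> R) (m theta l : R) :
  0 < theta -> l <= 1 ->
  l <= M%:R * \sum_t \sum_u P t * P u * (1 - cos (theta * (xi t - xi u))) ->
  l / 4 <= theta *
    mean (iid P) (fun c : {ffun 'I_M -> T} => `|\sum_j xi (c j) - m|).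
Proof.
move=> th0 l1; set q := (X in _ * X) => lq.
have [P0 P1] := dP.
have [I0 I1] := iid_dist M dP.
pose g t := theta * xi t.
have := chf_symmetrized g; have := chf_iid P g M.
under eq_bigr => t _ do under eq_bigr => u _ do rewrite /g -mulrBr.
rewrite -/q; set r := _ + mean P _ ^+ 2.
set A := mean (iid P) _; set B := mean (iid P) _ => AB rq.
have r0 : 0 <= r by rewrite addr_ge0 ?sqr_ge0.
have q0 : 0 <= q.
  apply: sumr_ge0 => t _; apply: sumr_ge0 => u _.
  by rewrite !mulr_ge0 ?subr_ge0 ?cos_le1.
pose C := mean (iid P)
  (fun c : {ffun 'I_M -> T} => cos (\sum_j g (c j) - theta * m)).
have CE : C = A * cos (theta * m) + B * sin (theta * m).
  rewrite /A /B /C ![_ * cos _]mulrC ![_ * sin _]mulrC -!meanZ -meanD.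
  by apply: eq_mean => c; rewrite cosB; ring.
have Cr : C ^+ 2 <= (1 - q) ^+ M.
  rewrite -rq -AB CE; have := cos2Dsin2 (theta * m).
  set x := cos _; set y := sin _ => xy.
  have -> : A ^+ 2 + B ^+ 2 = (A ^+ 2 + B ^+ 2) * (x ^+ 2 + y ^+ 2).
    by rewrite xy mulr1.
  (* Cauchy-Schwarz in the plane, through Lagrange's identity. *)
  rewrite -subr_ge0.
  have -> : (A ^+ 2 + B ^+ 2) * (x ^+ 2 + y ^+ 2) - (A * x + B * y) ^+ 2 =
    (A * y - B * x) ^+ 2 by ring.
  exact: sqr_ge0.
have CD : 1 - C <= theta *
    mean (iid P) (fun c : {ffun 'I_M -> T} => `|\sum_j xi (c j) - m|).
  rewrite -{1}(mean_cst 1 (iid_dist M dP)) /C -meanB -meanZ.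
  apply: ler_mean => // c; apply: le_trans (cos_ge1B _) _.
  by rewrite -mulr_sumr -mulrBr normrM (gtr0_norm th0).
apply: le_trans CD.
have q1 : 0 <= q <= 1 by lra.
have := onem_exp_le M q1.
have : 0 <= (1 - q) ^+ M by apply: exprn_ge0; lra.
move: Cr lq; set D := (1 - q) ^+ M; set Q := M%:R * q => Cr lq D0 DQ.
have Q0 : 0 <= Q by rewrite mulr_ge0.
have [l0|l0] := leP l 0; first by nra.
(* [1 - C >= (1 - C^2) / 2 >= (1 - D) / 2] and [D <= 1 / (1 + l)] *)
have : D * (1 + l) <= 1 by nra.
have := sqr_ge0 (1 - C); nra.
Qed.

End MeanDeviationLower.

(** * Upper bound on the mean deviation by truncation *)

Section MeanDeviationUpper.
Context {R : realType}.
Variables (T : finType) (P : T -> R).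
Hypothesis dP : is_dist P.

(** The common bound is [x (x/a)^(lam - 1)]. Below [a], [x/a <= (x/a)^(lam - 1)] because [lam <= 2];
    above [a], [(x/a)^(lam - 1) >= 1] because [lam >= 1]. *)
Lemma truncated_moments (x a lam : R) : 0 <= x -> 0 < a -> 1 <= lam <= 2 ->
  (x <= a -> x ^+ 2 <= a * (a `^ (1 - lam) * x `^ lam)) /\
  (a <= x -> x <= a `^ (1 - lam) * x `^ lam).
Proof.
move=> x0 a0 /andP[lam1 lam2].
have aE : a `^ (1 - lam) = (a `^ (lam - 1))^-1 by rewrite -powRN opprB.
have v0 : 0 < a `^ (lam - 1) by rewrite powR_gt0.
have xE : x `^ lam = x * x `^ (lam - 1) by rewrite mulr_powRB1 //; lra.
split=> xa.
  move: x0; rewrite le_eqVlt => /predU1P[<-|x0].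
    by rewrite expr0n /= !mulr_ge0 ?powR_ge0 // ltW.
  have split2 (y : R) : 0 < y -> y = y `^ (lam - 1) * y `^ (2 - lam).
    move=> y0; rewrite -powRD; last by rewrite (gt_eqF y0) implybT.
    by rewrite [_ + _](_ : _ = 1) ?powRr1 ?ltW //; ring.
  have w : x `^ (2 - lam) <= a `^ (2 - lam).
    by apply: ge0_ler_powR => //; rewrite ?nnegrE; lra.
  rewrite xE aE expr2 {1}(split2 _ a0).
  rewrite [leRHS](_ : _ = x * (x `^ (lam - 1) * a `^ (2 - lam))); last first.
    by field; rewrite gt_eqF.
  apply: ler_wpM2l; first exact: ltW.
  by rewrite {1}(split2 _ x0); apply: ler_wpM2l; first exact: powR_ge0.
rewrite xE aE mulrCA ler_peMr // mulrC ler_pdivlMr // mul1r.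
by apply: ge0_ler_powR => //; rewrite ?nnegrE; lra.
Qed.

Variable xi : T -> R.
Hypothesis xi0 : forall t, 0 <= xi t.

(** Split [xi] at the level [a]. The part [x1] below it is controlled by its variance, the part [x2]
    above it by twice its mean; both moments are compared with the [lam]-th one. The weights are
    [1/2] for the variance and 2 for the mean, hence [5/2]. *)
Lemma mean_deviation_truncated_le (M : nat) (lam a : R) :
  0 < a -> 1 <= lam <= 2 ->
  mean (iid P) (fun c : {ffun 'I_M -> T} =>
    `|\sum_j xi (c j) - M%:R * mean P xi|) <=
  a / 2 + 5 / 2 * (M%:R * (a `^ (1 - lam) * mean P (fun t => xi t `^ lam))).
Proof.
move=> a0 lam12; set k := a `^ (1 - lam).
have [P0 P1] := dP; have [I0 I1] := iid_dist M dP.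
pose x1 t := if xi t <= a then xi t else 0.
pose x2 t := if xi t <= a then 0 else xi t.
have x2_ge0 t : 0 <= x2 t by rewrite /x2; case: ifP.
have klam0 t : 0 <= k * xi t `^ lam by rewrite mulr_ge0 ?powR_ge0.
have x1_sqr t : x1 t ^+ 2 <= a * (k * xi t `^ lam).
  rewrite /x1; case: ifP => [xa|_]; last by rewrite expr0n /= mulr_ge0 // ltW.
  by have [H _] := truncated_moments (xi0 t) a0 lam12; apply: H.
have x2_le t : x2 t <= k * xi t `^ lam.
  rewrite /x2; case: (leP (xi t) a) => [//|xa].
  by have [_ H] := truncated_moments (xi0 t) a0 lam12; exact: H (ltW xa).
set m := mean P (fun t => xi t `^ lam).
have e1 : mean P (fun t => x1 t ^+ 2) <= a * (k * m).
  by rewrite -2!meanZ; apply: ler_mean.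
have e2 : mean P x2 <= k * m by rewrite -meanZ; apply: ler_mean.
have xiE t : xi t = x1 t + x2 t by rewrite /x1 /x2; case: ifP; rewrite ?addr0 ?add0r.
have -> : mean P xi = mean P x1 + mean P x2.
  by rewrite -meanD; apply: eq_mean.
apply: (@le_trans _ _ (mean (iid P) (fun c : {ffun 'I_M -> T} =>
   `|\sum_j x1 (c j) - M%:R * mean P x1| +
   (\sum_j x2 (c j) + M%:R * mean P x2)))).
  apply: ler_mean => // c; rewrite (eq_bigr _ (fun j _ => xiE (c j))).
  rewrite big_split /= mulrDr.
  rewrite [X in `|X|](_ : _ = (\sum_j x1 (c j) - M%:R * mean P x1) +
     (\sum_j x2 (c j) - M%:R * mean P x2)); last by ring.
  apply: le_trans (ler_normD _ _) _; rewrite lerD2l.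
  apply: le_trans (ler_normB _ _) _; rewrite !ger0_norm //.
    by rewrite mulr_ge0 // mean_ge0.
  exact: sumr_ge0.
rewrite !meanD mean_cst; last exact: iid_dist.
rewrite mean_iid_sum //.
apply: (@le_trans _ _ ((M%:R * (k * m) + a) / 2 + 2 * (M%:R * (k * m)))); last by lra.
apply: lerD; last first.
  have : M%:R * mean P x2 <= M%:R * (k * m) by apply: ler_wpM2l.
  lra.
apply: le_trans (mean_norm_le_sqr (iid_dist M dP) _ a0) _.
rewrite ler_pM2r ?invr_gt0 // lerD2r ler_pdivrMr //.
apply: le_trans (mean_iid_sqr_centered M dP x1) _.
by rewrite -mulrA; apply: ler_wpM2l => //; rewrite mulrC.
Qed.

Lemma mean_deviation_le (M : nat) (lam : R) : 1 <= lam <= 2 ->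
  mean (iid P) (fun c : {ffun 'I_M -> T} =>
    `|\sum_j xi (c j) - M%:R * mean P xi|) <=
  3 * (M%:R * mean P (fun t => xi t `^ lam)) `^ lam^-1.
Proof.
move=> lam12; have H (a : R) (a0 : 0 < a) := mean_deviation_truncated_le M a0 lam12.
set m := mean P (fun t => xi t `^ lam) in H *.
have [P0 _] := dP.
have lam0 : lam != 0 by rewrite gt_eqF //; lra.
have : 0 <= M%:R * m.
  by rewrite mulr_ge0 // mean_ge0 // => t; apply: powR_ge0.
(* The balancing level is 0 when [M m = 0]; then every positive level gives a bound, and letting it
   tend to 0 suffices. *)
rewrite le_eqVlt => /predU1P[Mm0|Mm0].
  rewrite -Mm0 powR0 ?invr_eq0 // mulr0.
  apply/ler_addgt0Pl => e e0; rewrite addr0; apply: le_trans (H e e0) _.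
  by rewrite [M%:R * _]mulrCA -Mm0; lra.
(* This level makes [M a^(1 - lam) m] equal to [a], so the total is [a/2 + 5a/2 = 3a]. *)
set a := (M%:R * m) `^ lam^-1.
have a0 : 0 < a by rewrite powR_gt0.
apply: le_trans (H a a0) _.
have -> : M%:R * (a `^ (1 - lam) * m) = a; last by lra.
have -> : M%:R * (a `^ (1 - lam) * m) = a `^ (1 - lam) * (M%:R * m) by ring.
have -> : M%:R * m = a `^ lam by rewrite -powRrM mulVf // powRr1 // ltW.
rewrite -powRD; last first.
  by rewrite (gt_eqF a0) implybT.
by rewrite subrK powRr1 // ltW.
Qed.

End MeanDeviationUpper.

(** * The variational problem *)

Section Divergence.
Context {R : realType} {T : finType}.

Lemma eq_mean_supp (P f g : T -> R) :
  (forall t, P t != 0 -> f t = g t) -> mean P f = mean P g.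
Proof.
move=> fg; apply: eq_bigr => t _.
by have [->|/fg->] := eqVneq (P t) 0; rewrite ?mul0r.
Qed.

(** Relative entropy in nats. It is real-valued: a point with [P t = 0] contributes [ln 0 = 0]
    instead of an infinite value, so the inclusion of supports is carried as a separate
    hypothesis. *)
Definition kl (Q P : T -> R) : R := mean Q (fun t => ln (Q t / P t)).

Lemma divR_kl (b : R) (Q P : T -> R) : divR b Q P = kl Q P / ln b.
Proof.
rewrite /divR /kl /mean mulr_suml big_mkcond; apply: eq_bigr => t _.
by case: eqVneq => [->|_]; rewrite ?mul0r // mulrA.
Qed.

Lemma ln_le_subr1 (u : R) : 0 < u -> ln u <= u - 1.
Proof.
by move=> u0; have := @le_ln1Dx R (u - 1); rewrite subrKC; apply; lra.
Qed.

Lemma kl_ge0 (Q P : T -> R) : is_dist Q -> is_dist P ->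
  (forall t, Q t != 0 -> P t != 0) -> 0 <= kl Q P.
Proof.
move=> [Q0 Q1] [P0 P1] QP.
rewrite -(subrr 1) -{1}Q1 -P1 -sumrB; apply: ler_sum => t _.
have [->|Qt] := eqVneq (Q t) 0; first by rewrite mul0r sub0r oppr_le0.
have q0 : 0 < Q t by rewrite lt_neqAle eq_sym Qt Q0.
have p0 : 0 < P t by rewrite lt_neqAle eq_sym QP // P0.
have := ln_le_subr1 (divr_gt0 p0 q0); rewrite !ln_div ?posrE // => h.
have -> : Q t - P t = Q t * (1 - P t / Q t) by field; rewrite gt_eqF.
by rewrite ler_pM2l //; lra.
Qed.

Lemma kl_self (P : T -> R) : kl P P = 0.
Proof.
apply: big1 => t _; have [->|Pt] := eqVneq (P t) 0; first by rewrite mul0r.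
by rewrite divff // ln1 mulr0.
Qed.

End Divergence.

Section Limits.
Context {R : realType}.

Lemma cvg_sum_fin (I : Type) (s : seq I) (q : pred I) (F : set_system R)
    (f : I -> R -> R) (l : I -> R) : Filter F ->
  (forall i, q i -> f i x @[x --> F] --> l i) ->
  \sum_(i <- s | q i) f i x @[x --> F] --> \sum_(i <- s | q i) l i.
Proof.
by move=> FF fl; apply: cvg_big => //; exact: add_continuous.
Qed.

Lemma cvg_expR (F : set_system R) (f : R -> R) (a : R) : Filter F ->
  f x @[x --> F] --> a -> expR (f x) @[x --> F] --> expR a.
Proof. by move=> FF; apply: continuous_cvg; exact: continuous_expR. Qed.

Lemma cvg_ln (F : set_system R) (f : R -> R) (a : R) : Filter F -> 0 < a ->
  f x @[x --> F] --> a -> ln (f x) @[x --> F] --> ln a.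
Proof. by move=> FF a0; apply: continuous_cvg; exact: continuous_ln. Qed.

End Limits.

(** * The tilted distributions and the Lagrangian *)

Section Tilting.
Context {R : realType} {X Y : finType}.
Variables (p : X -> R) (W : X -> Y -> R).
Hypotheses (dp : is_dist p) (dW : is_channel W).

Lemma mean_margY (Q : X * Y -> R) (g : Y -> R) :
  mean (margY Q) g = mean Q (fun z => g z.2).
Proof.
rewrite /mean /margY; under eq_bigr => y _ do rewrite mulr_suml.
by rewrite exchange_big pair_big; apply: eq_bigr => -[x y].
Qed.

Lemma margY_dist (Q : X * Y -> R) : is_dist Q -> is_dist (margY Q).
Proof.
move=> [Q0 Q1]; split=> [y|]; first by apply: sumr_ge0.
have := mean_margY Q (fun=> 1); rewrite (mean_cst _ (conj Q0 Q1)) => <-.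
by apply: eq_bigr => y _; rewrite mulr1.
Qed.

Lemma margY_neq0 (Q : X * Y -> R) (z : X * Y) :
  (forall t, 0 <= Q t) -> Q z != 0 -> margY Q z.2 != 0.
Proof.
case: z => x y Q0 Qz /=; rewrite gt_eqF // /margY (bigD1 x) //=.
by rewrite ltr_pwDl ?sumr_ge0 // lt_neqAle eq_sym Qz Q0.
Qed.

Lemma joint_dist : is_dist (joint p W).
Proof.
have [p0 p1] := dp; split=> [[x y]|].
  by rewrite mulr_ge0 // (dW _).1.
rewrite -(pair_bigA _ (fun x y => p x * W x y)) /= -[RHS]p1.
by apply: eq_bigr => x _; rewrite -mulr_sumr (dW x).2 mulr1.
Qed.

Lemma outdist_margY : outdist p W = margY (joint p W).
Proof. by []. Qed.

Lemma joint_neq0 (z : X * Y) : joint p W z != 0 ->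
  [/\ 0 < p z.1, 0 < W z.1 z.2 & 0 < outdist p W z.2].
Proof.
move=> h; move: (h); rewrite mulf_eq0 negb_or => /andP[pz Wz].
have [j0 _] := joint_dist.
split; rewrite lt_neqAle eq_sym ?pz ?Wz ?(margY_neq0 j0) //=.
- by case: dp.
- by case: (dW z.1).
- by apply: sumr_ge0 => x _; apply: j0 (x, _).
Qed.

(** Using [expR] and [ln] on the support, rather than powers, makes continuity in [lam]
    immediate. *)
Definition tiltA (lam : R) (y : Y) : R :=
  \sum_(x | W x y != 0) p x * expR (lam * ln (W x y)).

(** For [lam] other than 0 and 1, [lam / (lam - 1) * ln (tiltZ lam)] is Sibson's information in
    nats. Outputs of probability zero are excluded, since [expR (lam^-1 * ln 0)] would be 1. *)
Definition tiltZ (lam : R) : R :=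
  \sum_(y | outdist p W y != 0) expR (lam^-1 * ln (tiltA lam y)).

(* [p W^lam A^(1/lam - 1) / Z], the minimizer of the Lagrangian with
   multiplier [s = (lam - 1) / lam]. *)
Definition tilt (lam : R) (z : X * Y) : R :=
  if joint p W z == 0 then 0
  else expR (ln (p z.1) + lam * ln (W z.1 z.2) +
             (lam^-1 - 1) * ln (tiltA lam z.2) - ln (tiltZ lam)).

Lemma tiltA_powR (lam : R) (y : Y) : lam != 0 ->
  tiltA lam y = \sum_x p x * W x y `^ lam.
Proof.
move=> l0; rewrite /tiltA big_mkcond; apply: eq_bigr => x _.
by rewrite /powR; case: eqVneq => //= _; rewrite (negbTE l0) mulr0.
Qed.

Lemma tiltA_gt0 (lam : R) (z : X * Y) : joint p W z != 0 -> 0 < tiltA lam z.2.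
Proof.
move=> jz; have [pz Wz _] := joint_neq0 jz; have [p0 _] := dp.
rewrite /tiltA (bigD1 z.1) ?gt_eqF //= ltr_pwDl ?mulr_gt0 ?expR_gt0 //.
by apply: sumr_ge0 => x _; rewrite mulr_ge0 ?expR_ge0.
Qed.

Lemma outdist_neq0 (y : Y) :
  outdist p W y != 0 -> exists x, joint p W (x, y) != 0.
Proof.
move=> ry; apply/existsP; apply: contraNT ry => /existsPn H.
by apply/eqP/big1 => x _; have /negPn/eqP := H x.
Qed.

Lemma tiltA_outdist0 (lam : R) (y : Y) : outdist p W y = 0 -> tiltA lam y = 0.
Proof.
move=> ry; apply: big1 => x Wx.
have [j0 _] := joint_dist.
suff : p x = 0 by move=> ->; rewrite mul0r.
apply/eqP; apply: contraT => px.
have jx : joint p W (x, y) != 0 by rewrite mulf_neq0.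
by have [_ _] := joint_neq0 jx; rewrite /= ry ltxx.
Qed.

Lemma tiltA_outdist_gt0 (lam : R) (y : Y) :
  outdist p W y != 0 -> 0 < tiltA lam y.
Proof. by move=> /outdist_neq0[x /(tiltA_gt0 lam)]. Qed.

Lemma tiltZ_powR (lam : R) : lam != 0 ->
  tiltZ lam = \sum_y (\sum_x p x * W x y `^ lam) `^ lam^-1.
Proof.
move=> l0; rewrite /tiltZ big_mkcond; apply: eq_bigr => y _.
rewrite -tiltA_powR //; case: ifPn => [ry|/negPn/eqP ry].
  by rewrite /powR gt_eqF // tiltA_outdist_gt0.
by rewrite tiltA_outdist0 // powR0 // invr_eq0.
Qed.

Lemma tiltZ_gt0 (lam : R) : 0 < tiltZ lam.
Proof.
have [y ry] : exists y, outdist p W y != 0.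
  apply/existsP; have [_ r1] := margY_dist joint_dist.
  apply: contraT => /existsPn H; have := oner_neq0 R; rewrite -r1 big1 ?eqxx //.
  by move=> y _; have /negPn/eqP := H y.
rewrite /tiltZ (bigD1 y) //= ltr_pwDl ?expR_gt0 //.
by apply: sumr_ge0 => ? _; apply: expR_ge0.
Qed.

Lemma tilt_ge0 (lam : R) (z : X * Y) : 0 <= tilt lam z.
Proof. by rewrite /tilt; case: ifP => // _; apply: expR_ge0. Qed.

Lemma tilt_neq0 (lam : R) (z : X * Y) : (tilt lam z != 0) = (joint p W z != 0).
Proof.
rewrite /tilt; case: (eqVneq (joint p W z)) => [_|_]; first by rewrite eqxx.
by rewrite gt_eqF // expR_gt0.
Qed.

Lemma margY_tilt (lam : R) (y : Y) : outdist p W y != 0 ->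
  margY (tilt lam) y = expR (lam^-1 * ln (tiltA lam y) - ln (tiltZ lam)).
Proof.
move=> ry; have A0 := tiltA_outdist_gt0 lam ry.
have -> : margY (tilt lam) y =
    tiltA lam y * expR ((lam^-1 - 1) * ln (tiltA lam y) - ln (tiltZ lam)).
  rewrite /tiltA mulr_suml [RHS]big_mkcond; apply: eq_bigr => x _.
  rewrite /tilt /joint /=; case: (eqVneq (W x y) 0) => [->|Wx].
    by rewrite mulr0 eqxx.
  rewrite mulf_eq0 (negbTE Wx) orbF; case: eqVneq => [->|px].
    by rewrite !mul0r.
  have [p0 _] := dp.
  rewrite -addrA expRD expRD lnK ?posrE // lt_neqAle eq_sym px; exact: p0.
by rewrite -{1}(lnK A0) -expRD; congr expR; ring.
Qed.

Lemma tilt_dist (lam : R) : is_dist (tilt lam).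
Proof.
split; first exact: tilt_ge0.
have -> : \sum_z tilt lam z = \sum_y margY (tilt lam) y.
  by rewrite exchange_big pair_big; apply: eq_bigr => -[].
transitivity (tiltZ lam / tiltZ lam); last by rewrite divff // gt_eqF // tiltZ_gt0.
rewrite /tiltZ mulr_suml [RHS]big_mkcond -/(tiltZ lam); apply: eq_bigr => y _.
case: ifPn => [ry|/negPn/eqP ry].
  by rewrite margY_tilt // expRD expRN lnK // posrE tiltZ_gt0.
apply: big1 => x _; apply/eqP; have := tilt_neq0 lam (x, y).
case: eqVneq => // _ /esym jx; have [_ _] := joint_neq0 jx.
by rewrite ry ltxx.
Qed.

Lemma tilt1 : tilt 1 = joint p W.
Proof.
have A1 y : tiltA 1 y = outdist p W y.
  rewrite tiltA_powR ?oner_neq0 //; apply: eq_bigr => x _.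
  by rewrite powRr1 // (dW x).1.
have Z1 : tiltZ 1 = 1.
  rewrite /tiltZ -[RHS](margY_dist joint_dist).2 big_mkcond.
  apply: eq_bigr => y _; rewrite -outdist_margY.
  case: ifPn => [ry|/negPn/eqP -> //].
  by rewrite invr1 mul1r A1 lnK // -A1 posrE tiltA_outdist_gt0.
apply/funext => z; rewrite /tilt; case: eqVneq => [->//|jz].
have [pz Wz rz] := joint_neq0 jz.
by rewrite invr1 subrr mul0r addr0 Z1 ln1 subr0 mul1r expRD !lnK.
Qed.

Lemma ln_tilt_marg (lam : R) (z : X * Y) : joint p W z != 0 ->
  ln (tilt lam z / (p z.1 * margY (tilt lam) z.2)) =
  lam * ln (W z.1 z.2) - ln (tiltA lam z.2).
Proof.
move=> jz; have [pz Wz rz] := joint_neq0 jz.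
rewrite margY_tilt ?gt_eqF // /tilt (negbTE jz) ln_div ?posrE ?expR_gt0 //; last first.
  by rewrite mulr_gt0 ?expR_gt0.
by rewrite lnM ?posrE ?expR_gt0 // !expRK; ring.
Qed.

(* The Lagrangian with multiplier [s = (lam - 1) / lam] is a sum of divergences
   from [tilt lam], up to a constant. *)
Lemma lagrangianE (lam : R) (Q : X * Y -> R) : lam != 0 -> is_dist Q ->
  (forall z, Q z != 0 -> joint p W z != 0) ->
  kl Q (joint p W)
    - (lam - 1) / lam * kl Q (fun z => p z.1 * margY Q z.2) + ln (tiltZ lam) =
  lam^-1 * kl Q (tilt lam) +
    (lam - 1) / lam * kl (margY Q) (margY (tilt lam)).
Proof.
move=> l0 dQ QW; have [Q0 _] := dQ.
rewrite {4}/kl mean_margY /kl -!meanZ -(mean_cst (ln (tiltZ lam)) dQ).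
rewrite -meanB -!meanD; apply: eq_mean_supp => z Qz.
have jz := QW _ Qz; have [pz Wz rz] := joint_neq0 jz.
have q0 : 0 < Q z by rewrite lt_neqAle eq_sym Qz Q0.
have m0 : 0 < margY Q z.2.
  by rewrite lt_neqAle eq_sym margY_neq0 // sumr_ge0.
rewrite margY_tilt ?gt_eqF // /tilt (negbTE jz) /joint.
by rewrite !ln_div ?posrE ?mulr_gt0 ?expR_gt0 // !lnM ?posrE // !expRK; field.
Qed.

(** For [lam >= 1] both coefficients in [lagrangianE] are nonnegative, and so are the two
    divergences. Equality at [Q = tilt lam], where both vanish, is [lagrangian_tilt]. *)
Lemma lagrangian_ge (lam : R) (Q : X * Y -> R) : 1 <= lam -> is_dist Q ->
  (forall z, Q z != 0 -> joint p W z != 0) ->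
  - ln (tiltZ lam) <= kl Q (joint p W)
    - (lam - 1) / lam * kl Q (fun z => p z.1 * margY Q z.2).
Proof.
move=> l1 dQ QW; have l0 : 0 < lam by lra.
have := lagrangianE (lt0r_neq0 l0) dQ QW.
have k1 : 0 <= kl Q (tilt lam).
  by apply: kl_ge0 => //; [exact: tilt_dist|move=> z /QW; rewrite tilt_neq0].
have k2 : 0 <= kl (margY Q) (margY (tilt lam)).
  apply: kl_ge0; try exact: margY_dist; first exact/margY_dist/tilt_dist.
  move=> y Qy; have /existsP[x Qx] : [exists x, Q (x, y) != 0].
    apply: contraNT Qy => /existsPn H; apply/eqP/big1 => x _.
    by have /negPn/eqP := H x.
  apply: (@margY_neq0 _ (x, y)); first exact: tilt_ge0.
  by rewrite tilt_neq0 QW.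
have h1 : 0 <= lam^-1 * kl Q (tilt lam) by rewrite mulr_ge0 // invr_ge0 ltW.
have h2 : 0 <= (lam - 1) / lam * kl (margY Q) (margY (tilt lam)).
  by rewrite !mulr_ge0 ?invr_ge0 //; lra.
lra.
Qed.

Lemma lagrangian_tilt (lam : R) : lam != 0 ->
  kl (tilt lam) (joint p W) - (lam - 1) / lam *
    kl (tilt lam) (fun z => p z.1 * margY (tilt lam) z.2) = - ln (tiltZ lam).
Proof.
move=> l0; have /= := lagrangianE l0 (tilt_dist lam) _.
rewrite !kl_self !mulr0 addr0 => H; apply/eqP; rewrite -addr_eq0 H // => z.
by rewrite tilt_neq0.
Qed.

Definition tiltD (lam : R) : R :=
  kl (tilt lam) (fun z => p z.1 * margY (tilt lam) z.2).

Lemma tiltD_continuous (lam : R) : 0 < lam -> {for lam, continuous tiltD}.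
Proof.
move=> l0.
(* The support of [tilt l] does not depend on [l], so the sum has a fixed index set and continuity
   is checked term by term. *)
have -> : tiltD = fun l => \sum_(z | joint p W z != 0)
    expR (ln (p z.1) + l * ln (W z.1 z.2) +
             (l^-1 - 1) * ln (tiltA l z.2) - ln (tiltZ l)) *
    (l * ln (W z.1 z.2) - ln (tiltA l z.2)).
  apply/funext => l; rewrite /tiltD /kl /mean [RHS]big_mkcond.
  apply: eq_bigr => z _; case: ifPn => jz.
    by rewrite ln_tilt_marg // /tilt (negbTE jz).
  by rewrite /tilt (negPn jz) mul0r.
have cM (c : R) : l * c @[l --> lam] --> lam * c.
  by apply: cvgM; [exact: cvg_id|exact: cvg_cst].
have cA y : tiltA l y @[l --> lam] --> tiltA lam y.
  apply: cvg_sum_fin => x _; apply: cvgM; first exact: cvg_cst.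
  by apply: cvg_expR; exact: cM.
have clA y : outdist p W y != 0 ->
    ln (tiltA l y) @[l --> lam] --> ln (tiltA lam y).
  by move=> ry; apply: cvg_ln (cA y); exact: tiltA_outdist_gt0.
have cV : l^-1 @[l --> lam] --> lam^-1.
  by apply: cvgV; [rewrite gt_eqF|exact: cvg_id].
have cZ : tiltZ l @[l --> lam] --> tiltZ lam.
  apply: cvg_sum_fin => y ry; apply: cvg_expR.
  by apply: cvgM => //; exact: clA.
have clZ : ln (tiltZ l) @[l --> lam] --> ln (tiltZ lam).
  by apply: cvg_ln cZ; exact: tiltZ_gt0.
apply: cvg_sum_fin => z jz; have [_ _ rz] := joint_neq0 jz.
have cAz := clA z.2 (lt0r_neq0 rz).
apply: cvgM; last by apply: cvgB.
apply: cvg_expR; apply: cvgB => //; apply: cvgD.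
  by apply: cvgD => //; exact: cvg_cst.
by apply: cvgM => //; apply: cvgB => //; exact: cvg_cst.
Qed.

(** Complementary slackness: either the positive part sits at its kink, or the multiplier
    [(lam - 1) / lam] has its largest value [1/2]. The hypothesis says that the rate exceeds the
    mutual information, as [tilt 1] is the joint distribution. *)
Lemma exists_optimal_order (r : R) : tiltD 1 < r -> exists lam,
  [/\ 1 <= lam <= 2, tiltD lam <= r & tiltD lam = r \/ lam = 2].
Proof.
move: tiltD tiltD_continuous => D cD D1.
have [D2|D2] := leP (D 2) r.
  by exists 2; split; [apply/andP; split; lra|exact: D2|right].
have [|||lam] := @IVT R D 1 2 r; first by lra.
- apply: continuous_in_subspaceT => lam; rewrite inE /= in_itv /= => /andP[l1 _].
  by apply: cD; lra.
- by rewrite ge_min le_max (ltW D1) (ltW D2) orbT.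
rewrite in_itv /= => l12 Dl; exists lam; split; [exact: l12| |by left].
by rewrite Dl.
Qed.

End Tilting.

(** * Deviation carried by a set of atypically large values; weak typicality *)

Section Typicality.
Context {R : realType}.
Variables (T : finType) (P : T -> R).
Hypothesis dP : is_dist P.

(** Markov's inequality at twice the mean. *)
Lemma mean_half_le (xi : T -> R) : (forall t, 0 <= xi t) -> 0 < mean P xi ->
  1 / 2 <= \sum_(t | xi t <= 2 * mean P xi) P t.
Proof.
move=> xi0 mu0; set mu := mean P xi in mu0 *; have [P0 P1] := dP.
have : 2 * mu * \sum_(t | ~~ (xi t <= 2 * mu)) P t <= mu.
  rewrite mulr_sumr big_mkcond /mu /mean; apply: ler_sum => t _.
  case: (leP (xi t)) => /= [_|h]; first by rewrite mulr_ge0.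
  by rewrite mulrC; apply: ler_wpM2l => //; exact: ltW.
have : \sum_(t | xi t <= 2 * mu) P t + \sum_(t | ~~ (xi t <= 2 * mu)) P t = 1.
  by rewrite -[RHS]P1 [RHS](bigID (fun t => xi t <= 2 * mu)).
by move=> E; nra.
Qed.

(** Take [theta = 1 / (a K)] and keep only pairs with [t] in [A] and [xi u] at most twice the mean,
    hence at most [xi t / 2]. The phase then lies in [[k / (2K), 1]], so [1 - cos] is at least
    [k^2 / (32 K^2)]; Markov's inequality costs the remaining factor 2 in 64. *)
Lemma mean_deviation_ge_set (A : pred T) (M : nat) (xi : T -> R) (a k K l m : R) :
  (forall t, 0 <= xi t) -> 0 < mean P xi ->
  0 < a -> 0 < k -> 1 <= K -> l <= 1 ->
  (forall t, A t -> k * a <= xi t <= a) ->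
  (forall t, A t -> 4 * mean P xi <= xi t) ->
  l <= M%:R * (\sum_(t | A t) P t) * k ^+ 2 / (64 * K ^+ 2) ->
  l / 4 * (a * K) <=
    mean (iid P) (fun c : {ffun 'I_M -> T} => `|\sum_j xi (c j) - m|).
Proof.
move=> xi0 mu0 a0 k0 K1 l1 Aa Amu lM; set mu := mean P xi in mu0 Amu *.
have [P0 P1] := dP.
have K0 : 0 < K by lra.
have aK0 : 0 < a * K by rewrite mulr_gt0.
have th0 : 0 < (a * K)^-1 by rewrite invr_gt0.
have := @mean_deviation_ge R T P dP M xi m (a * K)^-1 l th0 l1.
set q := M%:R * _ => dev; have lq : l <= q.
  apply: (le_trans lM); rewrite /q -[leLHS]mulrA -[leLHS]mulrA; apply: ler_wpM2l => //.
  rewrite mulr_suml; pose B t := xi t <= 2 * mu.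
  rewrite [leRHS](bigID A) /= -[leLHS]addr0; apply: lerD; last first.
    apply: sumr_ge0 => t _; apply: sumr_ge0 => u _.
    by rewrite !mulr_ge0 ?subr_ge0 ?cos_le1.
  apply: ler_sum => t At; under [leRHS]eq_bigr => u _ do rewrite -mulrA.
  rewrite -mulr_sumr; apply: ler_wpM2l => //.
  rewrite (bigID B) /= -[leLHS]addr0; apply: lerD; last first.
    by apply: sumr_ge0 => u _; rewrite !mulr_ge0 ?subr_ge0 ?cos_le1.
  have step u : B u ->
      k ^+ 2 / (32 * K ^+ 2) <= 1 - cos ((a * K)^-1 * (xi t - xi u)).
    rewrite /B => Bu; have /andP[ka xa] := Aa t At; have mt := Amu t At.
    have u0 := xi0 u.
    set d := (a * K)^-1 * (xi t - xi u).
    have dl : k / (2 * K) <= d.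
      rewrite /d [leRHS]mulrC ler_pdivlMr // (_ : _ * (a * K) = k * a / 2).
        by lra.
      by field; rewrite gt_eqF.
    have d1 : d <= 1.
      rewrite /d mulrC ler_pdivrMr // mul1r.
      have : a <= a * K by rewrite ler_peMr // ltW.
      by lra.
    have kK0 : 0 < k / (2 * K) by rewrite divr_gt0 // mulr_gt0.
    apply: le_trans (sqr_le_1Bcos _); last by rewrite ger0_norm //; lra.
    have -> : k ^+ 2 / (32 * K ^+ 2) = (k / (2 * K)) ^+ 2 / 8.
      by field; rewrite gt_eqF.
    by nra.
  apply: (@le_trans _ _ (\sum_(u | B u) P u * (k ^+ 2 / (32 * K ^+ 2)))); last first.
    by apply: ler_sum => u Bu; apply: ler_wpM2l => //; exact: step.
  rewrite -mulr_suml; have := mean_half_le xi0 mu0; rewrite -/mu -/B => Bh.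
  have -> : k ^+ 2 / (64 * K ^+ 2) = 1 / 2 * (k ^+ 2 / (32 * K ^+ 2)).
    by field; rewrite gt_eqF.
  by apply: ler_wpM2r => //; rewrite divr_ge0 ?mulr_ge0 ?exprn_ge0 // ltW.
have /(ler_wpM2l (ltW aK0)) := dev lq; rewrite mulVKf ?gt_eqF //.
by rewrite mulrC.
Qed.

Definition typical (fs : seq (T -> R)) (d : R) (n : nat) (c : {ffun 'I_n -> T}) :=
  all (fun f => `|\sum_i f (c i) - n%:R * mean P f| <= n%:R * d) fs.

(** Chebyshev and the union bound at once: the indicator of the typical set is pointwise at least 1
    minus the sum of the squared deviations divided by [(n d)^2]. *)
Lemma typical_prob_ge (fs : seq (T -> R)) (d : R) (n : nat) :
  0 < d -> (0 < n)%N ->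
  1 - (\sum_(f <- fs) mean P (fun t => f t ^+ 2)) / (n%:R * d ^+ 2) <=
  mean (iid P) (fun c : {ffun 'I_n -> T} => (typical fs d c)%:R).
Proof.
move=> d0 n0; have n0' : 0 < n%:R :> R by rewrite ltr0n.
have [I0 I1] := iid_dist n dP.
pose dev f (c : {ffun 'I_n -> T}) := \sum_i f (c i) - n%:R * mean P f.
pose nd := n%:R * d; have ndp : 0 < nd by rewrite mulr_gt0.
have nd0 : 0 < nd ^+ 2 by rewrite exprn_gt0.
apply: (@le_trans _ _ (mean (iid P) (fun c : {ffun 'I_n -> T} =>
    1 - \sum_(f <- fs) (nd ^+ 2)^-1 * dev f c ^+ 2))).
  rewrite meanB mean_cst; last exact: iid_dist.
  rewrite mean_sum lerD2l lerN2 mulr_suml; apply: ler_sum => f _.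
  rewrite (meanZ _ _ (fun c => dev f c ^+ 2)).
  apply: (@le_trans _ _ ((nd ^+ 2)^-1 * (n%:R * mean P (fun t => f t ^+ 2)))).
    by apply: ler_wpM2l; [rewrite invr_ge0 ltW|exact: mean_iid_sqr_centered].
  rewrite le_eqVlt; apply/orP; left; apply/eqP; rewrite /nd.
  by field; rewrite !gt_eqF.
apply: ler_mean => // c; elim: fs => [|f fs IH]; first by rewrite big_nil subr0.
rewrite big_cons /typical /= -/(typical fs d c).
have q0 (f' : T -> R) : 0 <= (nd ^+ 2)^-1 * dev f' c ^+ 2.
  by rewrite mulr_ge0 ?sqr_ge0 // invr_ge0 ltW.
case: (leP _ (n%:R * d)) => [_|h] /=; first by have := q0 f; lra.
have : 1 <= (nd ^+ 2)^-1 * dev f c ^+ 2.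
  rewrite mulrC ler_pdivlMr // mul1r -[leRHS]real_normK ?num_real //.
  by rewrite ler_pXn2r ?nnegrE ?(ltW ndp) //; exact: ltW h.
have : 0 <= \sum_(f' <- fs) (nd ^+ 2)^-1 * dev f' c ^+ 2.
  by apply: sumr_ge0 => f' _; exact: q0.
lra.
Qed.

Lemma typical_prob_half (fs : seq (T -> R)) (d : R) : 0 < d ->
  exists N : nat, forall n, (N <= n)%N ->
    1 / 2 <= mean (iid P) (fun c : {ffun 'I_n -> T} => (typical fs d c)%:R).
Proof.
move=> d0; set S := \sum_(f <- fs) mean P (fun t => f t ^+ 2).
have [P0 _] := dP.
have S0 : 0 <= S.
  by apply: sumr_ge0 => f _; apply: mean_ge0 => // t; apply: sqr_ge0.
have d2 : 0 < d ^+ 2 by apply: exprn_gt0.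
have x0 : 0 <= 2 * S / d ^+ 2 by rewrite divr_ge0 ?mulr_ge0 // ltW.
exists (Num.bound (2 * S / d ^+ 2)).+1 => n nN.
have n0 : (0 < n)%N by apply: leq_trans nN.
apply: le_trans (typical_prob_ge fs d0 n0); rewrite -/S.
suff : S / (n%:R * d ^+ 2) <= 1 / 2 by lra.
rewrite ler_pdivrMr ?mulr_gt0 ?ltr0n //.
have : 2 * S / d ^+ 2 < n%:R.
  by apply: lt_le_trans (archi_boundP x0) _; rewrite ler_nat ltnW.
by rewrite ltr_pdivrMr // => h; lra.
Qed.

End Typicality.

(** * Bounds on the expected total variation distance *)

Section SoftCoveringUpper.
Context {R : realType} {X Y : finType}.
Variables (p : X -> R) (W : X -> Y -> R).
Hypotheses (dp : is_dist p) (dW : is_channel W).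

Definition avgTV (n M : nat) : R :=
  mean (iid (iid p)) (fun c : {ffun 'I_M -> {ffun 'I_n -> X}} =>
    \sum_y `|Defs.induced W c y - outn p W y|).

Definition lik (n : nat) (y : {ffun 'I_n -> Y}) (x : {ffun 'I_n -> X}) : R :=
  \prod_i W (x i) (y i).

Lemma W_ge0 (x : X) (y : Y) : 0 <= W x y.
Proof. exact: (dW x).1. Qed.

Lemma lik_ge0 (n : nat) (y : {ffun 'I_n -> Y}) (x : {ffun 'I_n -> X}) :
  0 <= lik y x.
Proof. by apply: prodr_ge0 => i _; apply: W_ge0. Qed.

Lemma mean_lik (n : nat) (y : {ffun 'I_n -> Y}) :
  mean (iid p) (lik y) = outn p W y.
Proof. exact: (mean_iid_prod p (fun i x => W x (y i))). Qed.

(** For fixed [y] the likelihoods of the codewords are independent with mean [outn p W y], so the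
    distance becomes a sum of mean deviations. *)
Lemma avgTVE (n M : nat) : (0 < M)%N -> avgTV n M =
  M%:R^-1 * \sum_y mean (iid (iid p)) (fun c : {ffun 'I_M -> {ffun 'I_n -> X}} =>
    `|\sum_j lik y (c j) - M%:R * outn p W y|).
Proof.
move=> M0; rewrite /avgTV mean_sum mulr_sumr; apply: eq_bigr => y _.
rewrite -meanZ; apply: eq_mean => c.
have M0' : 0 < M%:R :> R by rewrite ltr0n.
rewrite -[X in X * `|_|]gtr0_norm ?invr_gt0 // -normrM mulrBr mulKf // gt_eqF //.
Qed.

Lemma prodr_powR (n : nat) (f : 'I_n -> R) (a : R) : (forall i, 0 <= f i) ->
  (\prod_i f i) `^ a = \prod_i f i `^ a.
Proof.
(* Nonnegativity is carried along because powers are multiplicative only on nonnegative factors. *)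
move=> f0; pose K (u v : R) := 0 <= u /\ u `^ a = v.
suff [_ ->] : K (\prod_i f i) (\prod_i f i `^ a) by [].
apply: big_ind2; first by split; rewrite ?powR1.
- by move=> u1 v1 u2 v2 [u10 <-] [u20 <-]; split; rewrite ?mulr_ge0 ?powRM.
- by split.
Qed.

(** Apply [mean_deviation_le] for each output word. The [lam]-th moment is a product over letters,
    so its [1/lam] powers sum to the [n]-th power of [tiltZ]. *)
Lemma avgTV_le (n M : nat) (lam r : R) : 1 <= lam <= 2 ->
  expR (n%:R * r) <= M%:R ->
  avgTV n M <= 3 * expR (- (n%:R * ((lam - 1) / lam * r - ln (tiltZ p W lam)))).
Proof.
move=> lam12 rM; have /andP[lam1 lam2] := lam12.
have lam0 : 0 < lam by lra.
have M0 : 0 < M%:R :> R by apply: lt_le_trans rM; apply: expR_gt0.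
rewrite avgTVE -?(ltr0n R) //.
pose a y := \sum_x p x * W x y `^ lam.
have a0 y : 0 <= a y.
  by apply: sumr_ge0 => x _; rewrite mulr_ge0 ?powR_ge0 //; case: dp.
have aE (y : {ffun 'I_n -> Y}) :
    mean (iid p) (fun x => lik y x `^ lam) = \prod_i a (y i).
  rewrite -(mean_iid_prod p (fun i x => W x (y i) `^ lam)); apply: eq_mean => x.
  by rewrite /lik prodr_powR // => i; apply: W_ge0.
apply: (@le_trans _ _ (M%:R^-1 * \sum_(y : {ffun 'I_n -> Y})
    3 * (M%:R `^ lam^-1 * \prod_i a (y i) `^ lam^-1))).
  apply: ler_wpM2l; first by rewrite invr_ge0 ltW.
  apply: ler_sum => y _; rewrite -mean_lik.
  have := mean_deviation_le (iid_dist n dp) (lik_ge0 y) M lam12.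
  move=> /le_trans; apply.
  by rewrite aE powRM ?(ltW M0) ?prodr_ge0 // prodr_powR.
rewrite -mulr_sumr -mulr_sumr.
have -> : \sum_(y : {ffun 'I_n -> Y}) \prod_i a (y i) `^ lam^-1 =
    expR (n%:R * ln (tiltZ p W lam)).
  have Z0 := tiltZ_gt0 dp dW lam.
  rewrite expRM_natl lnK // (tiltZ_powR dp dW) ?gt_eqF //.
  by rewrite -[in RHS](card_ord n) -prodr_const bigA_distr_bigA.
(* The factor [M] cancels the normalization of the codebook and leaves [M^(-s)] with
   [s = (lam - 1) / lam]. *)
have -> : M%:R `^ lam^-1 = M%:R * expR (- ((lam - 1) / lam * ln M%:R)).
  rewrite -{2}[M%:R]lnK // -expRD /powR gt_eqF //; congr expR.
  by field; rewrite gt_eqF.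
rewrite mulrCA -mulrA mulKf ?gt_eqF // -expRD ler_pM2l // ler_expR.
have lnM : n%:R * r <= ln M%:R.
  by rewrite -[leLHS]expRK ler_ln ?posrE ?expR_gt0.
have s0 : 0 <= (lam - 1) / lam by rewrite divr_ge0 //; lra.
nra.
Qed.

End SoftCoveringUpper.

(** * Typical likelihoods exceed the output probability *)

Section Gap.
Context {R : realType}.

(** With [u = expR t] this reads [u - 1 <= u^lam ln u]. The case [lam = 1] is [1 - t <= expR (- t)],
    and a larger [lam] increases the right side for either sign of [t]. *)
Lemma powR_ln_ge (lam t : R) : 1 <= lam -> expR t - 1 <= expR (lam * t) * t.
Proof.
move=> lam1; apply: (@le_trans _ _ (expR t * t)).
  have := ler_wpM2l (expR_ge0 t) (expR_ge1Dx (- t)); rewrite expRxMexpNx_1; lra.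
have [t0|t0] := leP 0 t.
  by apply: ler_wpM2r => //; rewrite ler_expR ler_peMl.
by apply: ler_wnM2r; [exact: ltW|rewrite ler_expR; nra].
Qed.

Lemma powR_ln_gt (lam t : R) : 1 <= lam -> t != 0 ->
  expR t - 1 < expR (lam * t) * t.
Proof.
move=> lam1 t0; apply: (@lt_le_trans _ _ (expR t * t)).
  have h : 1 + - t < expR (- t) by apply: expR_gt1Dx; rewrite oppr_eq0.
  have : expR t * (1 + - t) < expR t * expR (- t) by rewrite ltr_pM2l ?expR_gt0.
  by rewrite expRxMexpNx_1; lra.
have [t1|t1] := leP 0 t.
  by apply: ler_wpM2r => //; rewrite ler_expR ler_peMl.
by apply: ler_wnM2r; [exact: ltW|rewrite ler_expR; nra].
Qed.

Context {X Y : finType}.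
Variables (p : X -> R) (W : X -> Y -> R).
Hypotheses (dp : is_dist p) (dW : is_channel W).

(* Writing [u = W / r] with [r] the output distribution, [tilt lam] is
   [c(y) p u^lam], and [u^lam ln u >= u - 1] while [sum_x p (u - 1) = 0]. *)
Lemma tilt_gap_gt0 (lam : R) : 1 <= lam ->
  (exists x y, p x * W x y != p x * outdist p W y) ->
  0 < mean (tilt p W lam) (fun z => ln (W z.1 z.2 / outdist p W z.2)).
Proof.
move=> lam1 [x0 [y0 xy0]]; have [p0 _] := dp.
set r := outdist p W in xy0 *.
pose c y := if r y == 0 then 0 else
  expR (lam * ln (r y) + (lam^-1 - 1) * ln (tiltA p W lam y) - ln (tiltZ p W lam)).
(* The subtracted term sums to zero over [x] for each [y]; removing it makes every summand
   nonnegative. *)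
pose d (z : X * Y) := tilt p W lam z * ln (W z.1 z.2 / r z.2) -
  c z.2 * (p z.1 * (W z.1 z.2 / r z.2 - 1)).
have c0 y : 0 <= c y by rewrite /c; case: ifP => // _; apply: expR_ge0.
have dE z : joint p W z != 0 -> let t := ln (W z.1 z.2 / r z.2) in
    d z = c z.2 * p z.1 * (expR (lam * t) * t - (expR t - 1)).
  move=> jz t; have [pz Wz rz] := joint_neq0 dp dW jz.
  have -> : d z = tilt p W lam z * t - c z.2 * (p z.1 * (expR t - 1)).
    by rewrite /d /t lnK // posrE divr_gt0.
  have -> : tilt p W lam z = c z.2 * p z.1 * expR (lam * t).
    rewrite /c gt_eqF // /tilt (negbTE jz) -{2}(lnK (x := p z.1)) ?posrE //.
    by rewrite -!expRD /t ln_div ?posrE //; congr expR; ring.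
  by ring.
have d0E z : joint p W z = 0 -> d z = c z.2 * p z.1.
  move=> jz; rewrite /d /tilt jz eqxx mul0r sub0r.
  move: jz => /eqP; rewrite mulf_eq0 => /orP[]/eqP ->.
    by rewrite !(mul0r, mulr0) oppr0.
  by rewrite mul0r; ring.
have d_ge0 z : 0 <= d z.
  have [jz|jz] := eqVneq (joint p W z) 0; first by rewrite d0E // mulr_ge0.
  rewrite dE //= !mulr_ge0 // subr_ge0; exact: powR_ln_ge.
have sum_d : mean (tilt p W lam) (fun z => ln (W z.1 z.2 / r z.2)) = \sum_z d z.
  rewrite sumrB -[LHS]subr0; congr (_ - _); apply/esym.
  rewrite -(pair_bigA _ (fun x y => c y * (p x * (W x y / r y - 1)))) /=.
  rewrite exchange_big big1 //= => y _; rewrite -mulr_sumr.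
  have [ry|ry] := eqVneq (r y) 0; first by rewrite /c ry eqxx mul0r.
  under eq_bigr => x _ do rewrite mulrBr mulr1 mulrA.
  by rewrite sumrB -mulr_suml (dp.2) -/(outdist p W y) divff // subrr mulr0.
rewrite sum_d (bigD1 (x0, y0)) //= ltr_pwDl ?sumr_ge0 //.
have px : 0 < p x0.
  rewrite lt_neqAle p0 andbT eq_sym; apply: contraNneq xy0 => ->.
  by rewrite !mul0r.
have ry : r y0 != 0.
  apply: contraNneq xy0 => ry; rewrite ry mulr0.
  apply/eqP; apply/eqP; apply: contraT => jz.
  by have [_ _] := joint_neq0 dp dW (z := (x0, y0)) jz; rewrite -/r /= ry ltxx.
have cy : 0 < c y0 by rewrite /c (negbTE ry) expR_gt0.
(* Strictness at the non-degenerate pair: a vanishing likelihood leaves [c p > 0], and otherwise [u]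
   differs from 1, so the inequality is strict. *)
have [jz|jz] := eqVneq (joint p W (x0, y0)) 0; first by rewrite d0E // mulr_gt0.
have [_ Wz rz] := joint_neq0 dp dW jz.
rewrite dE //= mulr_gt0 ?mulr_gt0 // subr_gt0 powR_ln_gt //.
rewrite ln_eq0 ?divr_gt0 //; apply: contraNneq xy0 => /(congr1 ( *%R^~ (r y0))).
by rewrite mul1r divfK // => ->.
Qed.

End Gap.

(** * Lower bound for the random codebook by change of measure *)

Section SoftCoveringLower.
Context {R : realType} {X Y : finType}.

Lemma prodr_expR_ln (n : nat) (f : 'I_n -> R) : (forall i, 0 < f i) ->
  \prod_i f i = expR (\sum_i ln (f i)).
Proof. by move=> f0; rewrite expR_sum; apply: eq_bigr => i _; rewrite lnK ?posrE. Qed.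

Definition pairf (n : nat) (x : {ffun 'I_n -> X}) (y : {ffun 'I_n -> Y}) :
  {ffun 'I_n -> X * Y} := [ffun i => (x i, y i)].

Lemma sum_pairf (n : nat) (F : {ffun 'I_n -> X * Y} -> R) :
  \sum_y \sum_x F (pairf x y) = \sum_z F z.
Proof.
rewrite pair_big /= [RHS](reindex (fun u => pairf u.2 u.1)) //=.
exists (fun z => ([ffun i => (z i).2], [ffun i => (z i).1])) => [[y x] _|z _].
  by congr pair; apply/ffunP => i; rewrite !ffunE.
by apply/ffunP => i; rewrite !ffunE -surjective_pairing.
Qed.

Variables (p : X -> R) (W : X -> Y -> R).
Hypotheses (dp : is_dist p) (dW : is_channel W).
Variable Q : X * Y -> R.
Hypotheses (dQ : is_dist Q) (QW : forall z, Q z != 0 -> joint p W z != 0).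

Let lW (z : X * Y) := ln (W z.1 z.2).
Let lp (z : X * Y) := ln (Q z / p z.1).
Let lm (z : X * Y) := ln (margY Q z.2).
Let lg (z : X * Y) := ln (W z.1 z.2 / outdist p W z.2).
(** Typicality for these statistics controls, in order, the likelihood, the change of measure
    between [p] and [Q], the output marginal of [Q], and the ratio of the likelihood to the output
    probability. *)
Let logs := [:: lW; lp; lm; lg].

Section FixedLength.
Variables (n M : nat) (r d : R).
Let D := mean Q lp - mean Q lm.
Let E (a : R) := expR (n%:R * a).

Hypothesis d0 : 0 < d.
Hypothesis gap : 3 <= n%:R * (mean Q lg - d).
Hypothesis typ : 1 / 2 <=
  mean (iid Q) (fun z : {ffun 'I_n -> X * Y} => (typical Q logs d z)%:R).
Hypothesis rM : E r <= M%:R.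
Hypothesis Mr : M%:R <= 2 * E r.
Hypothesis Dr : D <= r.

(** Membership in the support of [Q] is imposed letter by letter so that every logarithm is genuine;
    the pairs this removes have probability zero. *)
Let A (y : {ffun 'I_n -> Y}) (x : {ffun 'I_n -> X}) :=
  typical Q logs d (pairf x y) && [forall i, Q (x i, y i) != 0].

Let t (y : {ffun 'I_n -> Y}) := \sum_(x | A y x) iid Q (pairf x y).

Let Emul (a b : R) : E a * E b = E (a + b).
Proof. by rewrite /E mulrDr expRD. Qed.

Lemma mass_ge0 (y : {ffun 'I_n -> Y}) : 0 <= t y.
Proof. by apply: sumr_ge0 => x _; apply: iid_ge0. Qed.

Lemma sum_mass_ge : 1 / 2 <= \sum_y t y.
Proof.
apply: (le_trans typ); rewrite /mean -sum_pairf; apply: ler_sum => y _.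
rewrite /t [leRHS]big_mkcond; apply: ler_sum => x _; rewrite /A.
case: (typical _ _ _ _); last by rewrite mulr0 /=.
rewrite mulr1 /=; case: ifPn => // /forallPn[i /negPn/eqP Qi].
by rewrite /iid (bigD1 i) //= ffunE Qi mul0r.
Qed.

Lemma slice_bounds (y : {ffun 'I_n -> Y}) (x : {ffun 'I_n -> X}) : A y x ->
  [/\ E (mean Q lW - d) <= lik W y x <= E (mean Q lW + d),
      E (- (mean Q lp + d)) * iid Q (pairf x y) <= iid p x,
      \prod_i margY Q (y i) <= E (mean Q lm + d),
      0 < outn p W y &
      4 * outn p W y <= lik W y x].
Proof.
move=> /andP[/and5P[tW tp tm tg _] /forallP Qxy].
have [Q0 _] := dQ.
have qi i : 0 < Q (x i, y i) by rewrite lt_neqAle eq_sym Qxy Q0.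
have pos i := joint_neq0 dp dW (QW (Qxy i)).
have Wi i : 0 < W (x i) (y i) by have [] := pos i.
have pi i : 0 < p (x i) by have [] := pos i.
have ri i : 0 < outdist p W (y i) by have [] := pos i.
have mi i : 0 < margY Q (y i).
  rewrite lt_neqAle eq_sym (margY_neq0 (z := (x i, y i))) //=.
  by apply: sumr_ge0.
have bounds (f : X * Y -> R) (s : R) :
    `|\sum_i f (pairf x y i) - n%:R * mean Q f| <= n%:R * d ->
    \sum_i f (x i, y i) = s -> n%:R * (mean Q f - d) <= s <= n%:R * (mean Q f + d).
  under eq_bigr => i _ do rewrite ffunE.
  by move=> h <-; move: h; rewrite ler_norml => /andP[h1 h2]; apply/andP; split; lra.
have likE : lik W y x = expR (\sum_i lW (x i, y i)) by rewrite /lik prodr_expR_ln.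
have /andP[g1 _] := bounds _ _ tg erefl.
have outn_gt0 : 0 < outn p W y by apply: prodr_gt0.
split=> //.
- by rewrite likE !ler_expR; exact: bounds tW erefl.
- have -> : iid p x = iid Q (pairf x y) * expR (- \sum_i lp (x i, y i)).
    rewrite -sumrN expR_sum /iid -big_split; apply: eq_bigr => i _ /=.
    rewrite ffunE /lp /= expRN lnK ?posrE ?divr_gt0 // invf_div.
    by rewrite mulrCA divff ?mulr1 // gt_eqF.
  rewrite mulrC; apply: ler_wpM2l; first exact: iid_ge0.
  by rewrite ler_expR mulrN lerN2; have /andP[] := bounds _ _ tp erefl.
- rewrite prodr_expR_ln // ler_expR.
  by have /andP[_ h] := bounds _ _ tm erefl.
- have -> : lik W y x = outn p W y * expR (\sum_i lg (x i, y i)).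
    rewrite expR_sum /outn /lik -big_split; apply: eq_bigr => i _ /=.
    rewrite /lg /= lnK ?posrE ?divr_gt0 // mulrCA divff ?mulr1 // gt_eqF //.
  (* By [gap] the exponent is at least 3, and [expR 3 >= 1 + 3]. *)
  rewrite mulrC ler_pM2l //; apply: le_trans (expR_ge1Dx _).
  by move: (le_trans gap g1); lra.
Qed.

(** Dropping the typicality constraint on [x] leaves the product marginal. This keeps the parameter
    [l] in [slice_deviation_ge] at most 1. *)
Lemma mass_le (y : {ffun 'I_n -> Y}) : t y <= \prod_i margY Q (y i).
Proof.
have -> : \prod_i margY Q (y i) = \sum_(x : {ffun 'I_n -> X}) iid Q (pairf x y).
  rewrite bigA_distr_bigA; apply: eq_bigr => x _.
  by rewrite /iid; apply: eq_bigr => i _; rewrite ffunE.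
rewrite /t big_mkcond; apply: ler_sum => x _.
by case: ifP => // _; exact: iid_ge0.
Qed.

(* The frequency is [1 / (a K)] with [a] the typical likelihood and
   [K = E ((r - D) / 2)] the standard deviation of the number of codewords in
   the slice, up to subexponential factors. *)
Lemma slice_deviation_ge (y : {ffun 'I_n -> Y}) :
  t y / 256 * E (mean Q lW - mean Q lm + (r - D) / 2 - 4 * d) <=
  mean (iid (iid p)) (fun c : {ffun 'I_M -> {ffun 'I_n -> X}} =>
    `|\sum_j lik W y (c j) - M%:R * outn p W y|).
Proof.
have [/existsP[x1 Ax1]|/existsPn noA] := boolP [exists x, A y x]; last first.
  have -> : t y = 0 by apply: big1 => x Ax; have := noA x; rewrite Ax.
  rewrite !mul0r; apply: mean_ge0 => //.
  by case: (iid_dist M (iid_dist n dp)).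
have [_ _ my out0 _] := slice_bounds Ax1.
pose h := - mean Q lm.
(* Lower bound for [M P(A) k^2 / (64 K^2)]: here [P(A) >= E (- (mean Q lp + d)) * t y], the
   likelihoods in the slice spread by [k = E (- 2 d)], and [K^2 = E (r - D)]; the exponents add up
   to [- mean Q lm - 5 d]. *)
pose l := E (h - 5 * d) * t y / 64.
have := @mean_deviation_ge_set R _ (iid p) (iid_dist n dp) (A y) M (lik W y)
  (E (mean Q lW + d)) (E (- (2 * d))) (E ((r - D) / 2)) l (M%:R * outn p W y).
rewrite mean_lik.
have n0 : (0 : R) <= n%:R by [].
have E0 a : 0 < E a by apply: expR_gt0.
have E1 a : 0 <= a -> 1 <= E a by move=> a0; rewrite -expR0 ler_expR mulr_ge0.
move=> H; apply: le_trans (H _ _ _ _ _ _ _ _ _) => {H} //.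
- rewrite /l le_eqVlt; apply/orP; left; apply/eqP.
  have -> : E (mean Q lW - mean Q lm + (r - D) / 2 - 4 * d) =
      E (h - 5 * d) * (E (mean Q lW + d) * E ((r - D) / 2)).
    by rewrite !Emul; congr E; rewrite /h; ring.
  by field.
- exact: lik_ge0.
- by apply: E1; rewrite divr_ge0 // subr_ge0.
- have : E (h - 5 * d) * t y <= 1.
    apply: (@le_trans _ _ (E (h - 5 * d) * E (mean Q lm + d))).
      by apply: ler_wpM2l; [exact: ltW|exact: le_trans (mass_le y) my].
    rewrite Emul -[leRHS]expR0 ler_expR mulr_ge0_le0 // /h; move: (d0); lra.
  rewrite /l; lra.
- move=> x Ax; have [bx _ _ _ _] := slice_bounds Ax.
  by rewrite Emul (_ : _ + _ = mean Q lW - d) //; ring.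
- by move=> x Ax; have [_ _ _ _] := slice_bounds Ax.
- have SA : E (- (mean Q lp + d)) * t y <= \sum_(x | A y x) iid p x.
    rewrite mulr_sumr; apply: ler_sum => x Ax.
    by have [] := slice_bounds Ax.
  rewrite ler_pdivlMr ?mulr_gt0 ?exprn_gt0 //.
  have -> : E ((r - D) / 2) ^+ 2 = E (r - D).
    by rewrite expr2 Emul; congr E; lra.
  have -> : E (- (2 * d)) ^+ 2 = E (- (4 * d)).
    by rewrite expr2 Emul; congr E; lra.
  have -> : l * (64 * E (r - D)) = E r * (E (- (mean Q lp + d)) * t y) * E (- (4 * d)).
    have -> : E r * (E (- (mean Q lp + d)) * t y) * E (- (4 * d)) =
       (E r * (E (- (mean Q lp + d)) * E (- (4 * d)))) * t y by ring.
    rewrite !Emul.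
    have -> : l * (64 * E (r - D)) = E (h - 5 * d) * E (r - D) * t y.
      by rewrite /l; field.
    by rewrite Emul; congr (E _ * _); rewrite /D /h; ring.
  apply: ler_wpM2r; first exact: ltW.
  by apply: ler_pM => //; [exact: ltW|rewrite mulr_ge0 ?mass_ge0 // ltW].
Qed.

(** Sum the slice bound over all [y]. The constant is 256 times 2 for the total slice mass [1/2],
    times 2 for [M <= 2 E r]. *)
Lemma avgTV_ge_fixed :
  E (- (mean Q lp - mean Q lW + (r - D) / 2 + 4 * d)) / 1024 <= avgTV p W n M.
Proof.
have final (u v s : R) : 0 < u -> 0 < v -> 1 / 2 <= s ->
    u / v / 1024 * (2 * v) <= s / 256 * u.
  move=> u0 v0 s2.
  have -> : u / v / 1024 * (2 * v) = 1 / 2 / 256 * u by field; rewrite gt_eqF.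
  apply: ler_wpM2r; first exact: ltW.
  by apply: ler_wpM2r s2; rewrite invr_ge0 ler0n.
have Er0 : 0 < E r by apply: expR_gt0.
have M0 : 0 < M%:R :> R by apply: lt_le_trans rM.
rewrite avgTVE -?(ltr0n R) //.
set e := E (mean Q lW - mean Q lm + (r - D) / 2 - 4 * d).
have e0 : 0 < e by apply: expR_gt0.
apply: (@le_trans _ _ (M%:R^-1 * \sum_y t y / 256 * e)); last first.
  apply: ler_wpM2l; first by rewrite invr_ge0 ltW.
  by apply: ler_sum => y _; exact: slice_deviation_ge.
rewrite -mulr_suml -mulr_suml [leRHS]mulrC ler_pdivlMr //.
have := sum_mass_ge; set S := \sum_y t y => S_ge.
have -> : E (- (mean Q lp - mean Q lW + (r - D) / 2 + 4 * d)) = e / E r.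
  by rewrite /e /E -expRB; congr expR; rewrite /D; field.
apply: (@le_trans _ _ (e / E r / 1024 * (2 * E r))).
  apply: ler_wpM2l Mr; apply: divr_ge0; last exact: ler0n.
  by apply: divr_ge0; apply: ltW.
exact: (final e (E r) S e0 Er0 S_ge).
Qed.

End FixedLength.

Lemma avgTV_ge (r d : R) : 0 < d -> 0 < mean Q lg ->
  kl Q (fun z => p z.1 * margY Q z.2) <= r ->
  exists N : nat, forall n M, (N <= n)%N ->
    expR (n%:R * r) <= M%:R <= 2 * expR (n%:R * r) ->
    expR (- (n%:R * (kl Q (joint p W) +
      (r - kl Q (fun z => p z.1 * margY Q z.2)) / 2 + d))) / 1024
      <= avgTV p W n M.
Proof.
have [Q0 _] := dQ.
have klD : kl Q (fun z => p z.1 * margY Q z.2) = mean Q lp - mean Q lm.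
  rewrite -meanB; apply: eq_mean_supp => z Qz.
  have [pz _ _] := joint_neq0 dp dW (QW Qz).
  have qz : 0 < Q z by rewrite lt_neqAle eq_sym Qz Q0.
  have mz : 0 < margY Q z.2 by rewrite lt_neqAle eq_sym margY_neq0 // sumr_ge0.
  by rewrite /lp /lm !ln_div ?posrE ?mulr_gt0 // lnM ?posrE //; ring.
have klJ : kl Q (joint p W) = mean Q lp - mean Q lW.
  rewrite -meanB; apply: eq_mean_supp => z Qz.
  have [pz Wz _] := joint_neq0 dp dW (QW Qz).
  have qz : 0 < Q z by rewrite lt_neqAle eq_sym Qz Q0.
  by rewrite /lp /lW /joint !ln_div ?posrE ?mulr_gt0 // lnM ?posrE //; ring.
rewrite klD klJ => d0 g0 Dr.
(* The first bound absorbs the loss [4 d']; the second leaves at least half of the gap, which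
   exceeds [3 / n] for large [n]. *)
pose d' := Num.min (d / 4) (mean Q lg / 2).
have d'0 : 0 < d' by rewrite lt_min; apply/andP; split; lra.
have d'd : d' <= d / 4 by rewrite ge_min lexx.
have d'g : d' <= mean Q lg / 2 by rewrite ge_min lexx orbT.
have [N HN] := typical_prob_half dQ logs d'0.
have x0 : 0 <= 6 / mean Q lg by rewrite divr_ge0 // ltW.
exists (maxn N (Num.bound (6 / mean Q lg))) => n M; rewrite geq_max => /andP[nN nB].
move=> /andP[rM Mr].
have ng : 3 <= n%:R * (mean Q lg - d').
  have : 6 / mean Q lg <= n%:R.
    by apply: le_trans (ltW (archi_boundP x0)) _; rewrite ler_nat.
  rewrite ler_pdivrMr // => h; have : (0 : R) <= n%:R by []; nra.
have := avgTV_ge_fixed d'0 ng (HN n nN) rM Mr Dr.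
apply: le_trans; apply: ler_wpM2r; first by rewrite invr_ge0 ler0n.
by rewrite ler_expR mulrN lerN2; apply: ler_wpM2l; [exact: ler0n|lra].
Qed.

End SoftCoveringLower.

(** * The exponent *)

Section Assembly.
Context {R : realType} {X Y : finType}.
Variables (b Rt : R) (p : X -> R) (W : X -> Y -> R).
Hypotheses (b1 : 1 < b) (dp : is_dist p) (dW : is_channel W).

Let lnb_gt0 : 0 < ln b.
Proof. by rewrite ln_gt0. Qed.

(** A nonnegative rate makes the rounded number at least 1, so rounding up at most doubles it. *)
Lemma codeM_bounds (n : nat) : 0 <= Rt ->
  expR (n%:R * (Rt * ln b)) <= (codeM b Rt n)%:R <=
  2 * expR (n%:R * (Rt * ln b)).
Proof.
move=> R0; have b0 : 0 < b by apply: lt_trans b1.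
have -> : expR (n%:R * (Rt * ln b)) = b `^ (n%:R * Rt).
  by rewrite /powR gt_eqF // mulrA.
rewrite /codeM; set x := b `^ _.
have x1 : 1 <= x.
  rewrite /x /powR gt_eqF // -expR0 ler_expR; apply: mulr_ge0; last exact: ltW.
  exact: mulr_ge0.
have c0 : 0 <= Num.ceil x by rewrite ceil_ge0; apply: lt_le_trans x1; lra.
rewrite natr_absz ger0_norm // ceil_ge /=.
by have := ltW (ceilB1_lt x); rewrite intrD; lra.
Qed.

Lemma mutinfo_tiltD : mutinfo b p W = tiltD p W 1 / ln b.
Proof. by rewrite /mutinfo divR_kl /tiltD (tilt1 dp dW). Qed.

Lemma mutinfo_ge0 : 0 <= mutinfo b p W.
Proof.
rewrite /mutinfo divR_kl divr_ge0 ?(ltW lnb_gt0) //.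
have [p0 p1] := dp; have [r0 r1] := margY_dist (joint_dist dp dW).
apply: kl_ge0; first exact: joint_dist.
  split=> [z|]; first by rewrite mulr_ge0 //; exact: r0.
  rewrite -(pair_bigA _ (fun x y => p x * outdist p W y)) /= -[RHS]p1.
  by apply: eq_bigr => x _; rewrite -mulr_sumr outdist_margY r1 mulr1.
move=> z jz; have [pz _ rz] := joint_neq0 dp dW jz.
by rewrite mulf_neq0 // gt_eqF.
Qed.

Lemma objL_tiltZ (lam : R) : 1 <= lam ->
  objL b Rt p W lam = ((lam - 1) / lam * (Rt * ln b) - ln (tiltZ p W lam)) / ln b.
Proof.
move=> lam1; have l0 : 0 < lam by lra.
have b0 : ln b != 0 by rewrite gt_eqF.
rewrite /objL /sibson; case: eqVneq => [->|lam_neq1].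
  (* At order 1 the prefactor kills the mutual information, so the normalizer must be 1; this is
     read off from the Lagrangian with multiplier zero. *)
  have Z1 : ln (tiltZ p W 1) = 0.
    have := lagrangian_tilt dp dW (oner_neq0 R).
    rewrite subrr !mul0r subr0 tilt1 // kl_self => /eqP.
    by rewrite eq_sym oppr_eq0 => /eqP.
  by rewrite Z1 subrr !mul0r subr0 mul0r.
rewrite /logb -(tiltZ_powR dp dW) ?gt_eqF //.
by field; rewrite b0 subr_eq0 lam_neq1 gt_eqF.
Qed.

Lemma objQ_kl (Q : X * Y -> R) : is_dist Q ->
  (forall z, Q z != 0 -> joint p W z != 0) ->
  objQ b Rt p W Q = ((kl Q (joint p W) +
    2^-1 * Num.max 0 (Rt * ln b - kl Q (fun z => p z.1 * margY Q z.2))) / ln b)%:E.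
Proof.
move=> dQ QW; have [Q0 _] := dQ.
have divE_kl P : (forall z, Q z != 0 -> P z != 0) -> divE b Q P = (kl Q P / ln b)%:E.
  move=> QP; rewrite /divE divR_kl ifN //; apply/existsPn => z.
  by apply/negP => /andP[/QP /negbTE ->].
rewrite /objQ !divE_kl //; last first.
  move=> z Qz; have [pz _ _] := joint_neq0 dp dW (QW _ Qz).
  by rewrite mulf_neq0 ?margY_neq0 // gt_eqF.
rewrite -EFinB -EFin_max -EFinM -EFinD; congr EFin.
rewrite mulrDl -mulrA; congr (_ + _ * _).
rewrite maxr_pMl ?invr_ge0 ?(ltW lnb_gt0) // mul0r mulrBl mulfK // gt_eqF //.
Qed.

Lemma objQ_infty (Q : X * Y -> R) (z : X * Y) :
  Q z != 0 -> joint p W z = 0 -> objQ b Rt p W Q = +oo%E.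
Proof.
move=> Qz jz; rewrite /objQ {1}/divE ifT; last first.
  by apply/existsP; exists z; rewrite Qz jz eqxx.
(* The second summand is nonnegative, so it cannot be the opposite infinity. *)
rewrite addye // gt_eqF //; apply: (@lt_le_trans _ _ 0%E) => //.
by rewrite mule_ge0 // ?lee_fin ?invr_ge0 // le_max lexx.
Qed.

Lemma slope_bounds (lam : R) : 1 <= lam <= 2 ->
  0 <= (lam - 1) / lam <= 2^-1.
Proof.
move=> /andP[l1 l2]; have l0 : 0 < lam by lra.
rewrite divr_ge0 ?(ltW l0) ?subr_ge0 //= ler_pdivrMr //; lra.
Qed.

Lemma expTV_avgTV (n : nat) : expTV b Rt p W n = avgTV p W n (codeM b Rt n).
Proof. by []. Qed.

Lemma exponent_cvg (T : nat -> R) (L : R) :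
  (forall n, T n <= 3 * expR (- (n%:R * L))) ->
  (forall d, 0 < d -> exists N, forall n, (N <= n)%N ->
    expR (- (n%:R * (L + d))) / 1024 <= T n) ->
  (fun n : nat => - (n%:R^-1 * logb b (T n))) @ \oo --> L / ln b.
Proof.
move=> ub lb; apply/cvgrPdist_le => e e0.
have eb0 : 0 < e * ln b by rewrite mulr_gt0.
have d0 : 0 < e * ln b / 2 by rewrite divr_gt0.
have [N HN] := lb _ d0.
have C1 : (1 : R) < 1024 by lra.
have C3 : (3 : R) <= 1024 by lra.
have C0 : (0 : R) < 1024 by lra.
(* From here on the constant matters only through [C > 1] and [C >= 3], and its logarithm disappears
   after division by [n]. *)
move: (1024 : R) C0 C1 C3 HN => C C0 C1 C3 HN.
have lnC : 0 < ln C by rewrite ln_gt0.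
have x0 : 0 <= ln C / (e * ln b / 2) by rewrite divr_ge0 // ltW.
near=> n.
have nN : (N <= n)%N by near: n; exact: nbhs_infty_ge.
have n0 : 0 < n%:R :> R by rewrite ltr0n; near: n; exact: nbhs_infty_gt.
have nC : ln C <= n%:R * (e * ln b / 2).
  rewrite -ler_pdivrMr //; apply: le_trans (ltW (archi_boundP x0)) _.
  by rewrite ler_nat; near: n; exact: nbhs_infty_ge.
have lbn := HN n nN.
have T0 : 0 < T n by apply: lt_le_trans lbn; rewrite divr_gt0 // expR_gt0.
have lnT1 : ln (T n) <= ln C - n%:R * L.
  have h : ln (T n) <= ln (3 * expR (- (n%:R * L))).
    by rewrite ler_ln ?posrE ?mulr_gt0 ?expR_gt0.
  apply: (le_trans h); rewrite lnM ?posrE ?expR_gt0 // expRK lerD2r.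
  by rewrite ler_ln ?posrE.
have lnT2 : - (n%:R * (L + e * ln b / 2)) - ln C <= ln (T n).
  rewrite -[X in X - _]expRK -ln_div ?posrE ?expR_gt0 //.
  by rewrite ler_ln ?posrE ?divr_gt0 ?expR_gt0.
have -> : L / ln b - - (n%:R^-1 * logb b (T n)) =
    (n%:R * L + ln (T n)) / (n%:R * ln b).
  by rewrite /logb; field; rewrite !gt_eqF.
rewrite normrM [X in _ * X]gtr0_norm ?invr_gt0 ?mulr_gt0 //.
rewrite ler_pdivrMr ?mulr_gt0 // ler_norml; apply/andP; split; nra.
Unshelve. all: by end_near. Qed.

End Assembly.

Unset Implicit Arguments.

Theorem theorem1 (R : realType) (X Y : finType) (b : R) (PX : X -> R)
  (W : X -> Y -> R) (Rt : R) :
  1 < b ->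
  is_dist PX -> is_channel W ->
  (exists x y, PX x * W x y != PX x * outdist PX W y) ->
  mutinfo b PX W < Rt ->
  exists L : R,
    ((fun n : nat => - (n%:R^-1 * logb b (expTV b Rt PX W n))) @ \oo --> L)
    /\ (exists Q : X * Y -> R, is_dist Q /\ objQ b Rt PX W Q = L%:E /\
          forall Q' : X * Y -> R, is_dist Q' -> (L%:E <= objQ b Rt PX W Q')%E)
    /\ (exists lam : R, 1 <= lam <= 2 /\ objL b Rt PX W lam = L /\
          forall lam' : R, 1 <= lam' <= 2 -> objL b Rt PX W lam' <= L).
Proof.
move=> b1 dp dW nondeg IR.
(* Weak duality in linear form, used both for an arbitrary [Q'] against the optimal order and for an
   arbitrary order against the optimal [Q]. *)
have dual (s a c u v w : R) :
  - u <= v - s * w -> s * (a - w) <= c -> s * a - u <= v + c by lra.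
have lnb0 : 0 < ln b by rewrite ln_gt0.
have Rt0 : 0 <= Rt by apply: ltW; apply: le_lt_trans IR; exact: mutinfo_ge0.
pose r := Rt * ln b.
have : tiltD PX W 1 < r by move: IR; rewrite mutinfo_tiltD // ltr_pdivrMr.
move=> /(exists_optimal_order dp dW)[lam [lam12 Dr Dlam]].
have /andP[lam1 lam2] := lam12.
have lam_neq0 : lam != 0 by rewrite gt_eqF //; lra.
pose Q := tilt PX W lam.
have dQ : is_dist Q := tilt_dist dp dW lam.
have QW z : Q z != 0 -> joint PX W z != 0 by rewrite tilt_neq0.
pose L := (lam - 1) / lam * r - ln (tiltZ PX W lam).
pose D1 := kl Q (joint PX W).
(* The dual value equals the primal one: either the bracket vanishes, or [lam = 2] and the
   multiplier is exactly [1/2]. *)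
have LE : L = D1 + (r - tiltD PX W lam) / 2.
  have := lagrangian_tilt dp dW lam_neq0.
  rewrite -/Q -/D1 -/(tiltD PX W lam) /L => /eqP.
  rewrite subr_eq => /eqP ->.
  by case: Dlam => [->|->]; field.
have objL_lam := objL_tiltZ Rt b1 dp dW.
have L_le (s a : R) : 0 <= s <= 2^-1 -> s * a <= 2^-1 * Num.max 0 a.
  move=> /andP[s0 s2]; rewrite maxEle.
  by have [a0|a0] := leP 0 a; rewrite ?a0 //; nra.
exists (L / ln b); split; [|split].
- apply: exponent_cvg => // [n|d d0].
    rewrite expTV_avgTV; apply: avgTV_le => //.
    by have /andP[] := codeM_bounds b1 n Rt0.
  have g0 := tilt_gap_gt0 dp dW lam1 nondeg.
  have [N HN] := avgTV_ge dp dW dQ QW d0 g0 Dr.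
  exists N => n nN; have := HN n (codeM b Rt n) nN (codeM_bounds b1 n Rt0).
  by rewrite -/(tiltD PX W lam) -/D1 LE.
- exists Q; split=> //; split=> [|Q' dQ'].
    rewrite objQ_kl //; congr (_ / _)%:E; rewrite LE -/D1 -/(tiltD PX W lam) -/r.
    by rewrite max_r ?subr_ge0 // mulrC.
  (* A competitor not absolutely continuous with respect to the joint distribution has infinite
     objective. *)
  have [[z [Qz jz]]|supp] := pselect (exists z, Q' z != 0 /\ joint PX W z = 0).
    by rewrite (objQ_infty _ _ Qz jz) leey.
  have Q'W z : Q' z != 0 -> joint PX W z != 0.
    by move=> Qz; apply/eqP => jz; apply: supp; exists z.
  rewrite objQ_kl // lee_fin ler_pM2r ?invr_gt0 //.
  exact: dual (lagrangian_ge dp dW lam1 dQ' Q'W) (L_le _ _ (slope_bounds lam12)).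
- exists lam; split=> //; split; first exact: objL_lam.
  move=> lam' lam'12; have /andP[lam'1 _] := lam'12.
  rewrite (objL_lam _ lam'1) ler_pM2r; last by rewrite invr_gt0.
  rewrite LE [X in _ <= _ + X]mulrC.
  apply: dual (lagrangian_ge dp dW lam'1 dQ QW) _.
  have := L_le _ (r - tiltD PX W lam) (slope_bounds lam'12).
  by rewrite max_r ?subr_ge0.
Qed.
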